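(* Let $n\geq2$ be an integer. Put $G=SO(n)$ and $H=SO(n-1)=\left\{\begin{pmatrix}1&\\&k\end{pmatrix}\,\middle|\,k\in SO(n-1)\right\}\subset G$. Let $\rho\colon G\to GL(\mathbb{R}^n)$ be the natural representation. Then $v_0:=e_1\in\mathbb{R}^n$ is $H$-fixed, and the family $\mathcal{P}$ obtained from $(G,H,\mathbb{R}^n,v_0)$ by the method described in the context, under the identification $SO(n)/SO(n-1)\simeq S^{n-1}$, $gSO(n-1)\mapsto ge_1$, is the family of von Mises--Fisher distributions on $S^{n-1}$, $$\left\{\frac{1}{(2\pi)^{\frac n2}\|\mu\|^{1-\frac n2}I_{\frac n2-1}(\|\mu\|)}\exp(-\mu^{T}x)\,dx\right\}_{\mu\in\mathbb{R}^n}.$$ Here $dx$ is the uniform measure on $S^{n-1}$ with $\int_{S^{n-1}}dx=\frac{2\pi^{n/2}}{\Gamma(n/2)}$.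
   Context: $e_1$ is the first standard basis vector. $I_m(r)=\sum_{j\geq0}\frac{1}{j!\,\Gamma(j+m+1)}\left(\frac r2\right)^{2j+m}$ is the modified Bessel function of the first kind of order $m$; at $\mu=0$ the expression $\|\mu\|^{1-\frac n2}I_{\frac n2-1}(\|\mu\|)$ is understood as its limit $\mu\to0$. The method: let $G$ be a Lie group with finitely many connected components, $H$ a closed subgroup, $X:=G/H$, $\rho\colon G\to GL(V)$ a continuous finite dimensional real representation and $v_0\in V$ an $H$-fixed vector. Put $W_0(G,H):=\{\tau\colon G\to\mathbb{R}\mid\tau\text{ is a continuous group homomorphism with }\tau|_H=0\}$. Take a nonzero relatively $G$-invariant Radon measure $\nu$ on $X$ (i.e. for some $\chi\colon G\to\mathbb{R}_{>0}$ the pushforward satisfies $g\cdot\nu=\chi(g)^{-1}\nu$ for all $g\in G$), assumed to exist; the resulting family does not depend on the choice of $\nu$. For $\theta=(\varphi,\tau)\in V^\vee\times W_0(G,H)$ and $x=gH$, put $\rho(x)v_0:=\rho(g)v_0$, $\tau(x):=\tau(g)$ and $d\tilde p_\theta(x):=\exp(-\langle\varphi,\rho(x)v_0\rangle+\tau(x))\,d\nu(x)$. Let $\Theta:=\{\theta\in V^\vee\times W_0(G,H)\mid\int_Xd\tilde p_\theta<\infty\}$ and, for $\theta\in\Theta$, $p_\theta:=(\int_Xd\tilde p_\theta)^{-1}\tilde p_\theta$. The family obtained is the set $\mathcal{P}:=\{p_\theta\}_{\theta\in\Theta}$ of probability measures on $X$. *)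

(* Defs.v *)
From HB Require Import structures.
From mathcomp Require Import all_boot all_order all_algebra.
From mathcomp Require Import all_classical all_reals all_analysis.

Set Implicit Arguments.
Unset Strict Implicit.
Unset Printing Implicit Defensive.

Import Order.TTheory GRing.Theory Num.Theory numFieldNormedType.Exports.
Local Open Scope classical_set_scope.
Local Open Scope ring_scope.

HB.mixin Record isTopologicalGroup G & Group G & PointedTopological G := {
  topgroup_mul_continuous : continuous (fun x : G * G => (x.1 * x.2)%g) ;
  topgroup_inv_continuous : continuous (fun x : G => (x^-1)%g)
}.

#[short(type="topGroupType")]
HB.structure Definition TopologicalGroup :=
  {G of Group G & PointedTopological G & isTopologicalGroup G}.

Record closedSubgroup (G : topGroupType) := ClosedSubgroup {
  subgroup_set :> G -> Prop ;
  subgroup1 : subgroup_set 1%g ;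
  subgroupM : forall x y, subgroup_set x -> subgroup_set y ->
    subgroup_set (x * y)%g ;
  subgroupV : forall x, subgroup_set x -> subgroup_set (x^-1)%g ;
  subgroup_closed : closed (subgroup_set : set G) }.

Section HomogeneousSpace.
Local Open Scope quotient_scope.
Variables (G : topGroupType) (H : closedSubgroup G).

Definition coset_rel (x y : G) : bool := `[< H (x^-1 * y)%g >].

Lemma coset_rel_refl : reflexive coset_rel.
Proof. by move=> x; apply/asboolP; rewrite mulVg; exact: subgroup1. Qed.

Lemma coset_rel_sym : symmetric coset_rel.
Proof.
move=> x y; apply/idP/idP => /asboolP /subgroupV;
  by rewrite invgM invgK => Hxy; apply/asboolP.
Qed.

Lemma coset_rel_trans : transitive coset_rel.
Proof.
move=> y x z /asboolP Hxy /asboolP Hyz; apply/asboolP.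
by have := subgroupM Hxy Hyz; rewrite -mulgA (mulgA y) mulgV mul1g.
Qed.

Definition coset_equiv :=
  EquivRel coset_rel coset_rel_refl coset_rel_sym coset_rel_trans.

(* [homspace] is G/H, the set of left cosets, with the quotient topology. *)
Definition homspace := quotient_topology {eq_quot coset_equiv}.
HB.instance Definition _ := PointedTopological.on homspace.
HB.instance Definition _ := Quotient.on homspace.

Definition gcoset (g : G) : homspace := \pi_homspace g.

Definition coset_act (g : G) (x : homspace) : homspace :=
  gcoset (g * repr x)%g.

End HomogeneousSpace.

Definition borel (T : ptopologicalType) : Type := g_sigma_algebraType (@open T).
HB.instance Definition _ (T : ptopologicalType) :=
  Measurable.copy (borel T) (g_sigma_algebraType (@open T)).

Local Open Scope ereal_scope.

Definition radon (R : realType) (T : ptopologicalType)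
    (mu : {measure set (borel T) -> \bar R}) : Prop :=
  [/\ forall K : set T, compact K -> mu K < +oo,
      forall A : set (borel T), measurable A ->
        mu A = ereal_inf [set mu U | U in [set U : set T | open U /\ A `<=` U]]
    & forall U : set T, open U ->
        mu U = ereal_sup
          [set mu K | K in [set K : set T | compact K /\ K `<=` U]]].

Definition relatively_invariant (R : realType) (G : topGroupType)
    (H : closedSubgroup G) (nu : {measure set (borel (homspace H)) -> \bar R}) :
    Prop :=
  exists chi : G -> R, (forall g, (0 < chi g)%R) /\
    forall (g : G) (A : set (borel (homspace H))), measurable A ->
      pushforward nu (coset_act g : borel (homspace H) -> borel (homspace H)) A
      = ((chi g)^-1)%:E * nu A.

(* MathComp-Analysis measures are functions on all sets, whose values outside
   the sigma-algebra are junk, so measures are compared on Borel sets only. *)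
Definition same_measure_family (R : realType) (T : ptopologicalType)
    (P Q : set (set (borel T) -> \bar R)) : Prop :=
  (forall p, P p -> exists2 q, Q q & forall A, measurable A -> p A = q A) /\
  (forall q, Q q -> exists2 p, P p & forall A, measurable A -> p A = q A).

(* V is taken to be R^d; invertibility of [rho g] follows from the other
   axioms. *)
Record continuousRep (R : realType) (G : topGroupType) (d : nat) :=
  ContinuousRep {
    rep_mx :> G -> 'M[R]_d ;
    rep_mx1 : rep_mx 1%g = 1%:M ;
    rep_mxM : forall g h, rep_mx (g * h)%g = rep_mx g *m rep_mx h ;
    rep_mx_continuous : continuous rep_mx }.

Definition fixed_by (R : realType) (G : topGroupType) (H : closedSubgroup G)
    (d : nat) (rho : continuousRep R G d) (v : 'cV[R]_d) : Prop :=
  forall h, H h -> rho h *m v = v.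

Definition W0 (R : realType) (G : topGroupType) (H : closedSubgroup G) :
    set (G -> R) :=
  [set tau | [/\ continuous tau,
                 forall g h, tau (g * h)%g = (tau g + tau h)%R
               & forall h, H h -> tau h = 0%R]].

Section Family.
Variables (R : realType) (G : topGroupType) (H : closedSubgroup G) (d : nat).
Variables (rho : continuousRep R G d) (v0 : 'cV[R]_d).
Variable nu : {measure set (borel (homspace H)) -> \bar R}.

(* [repr x] is a representative of the coset x; the value does not depend on it
   when v0 is H-fixed and tau vanishes on H. *)
Definition density (theta : {scalar 'cV[R]_d} * (G -> R))
    (x : borel (homspace H)) : R :=
  let g := repr (x : homspace H) in
  expR (- theta.1 (rho g *m v0) + theta.2 g).

Definition p_tilde theta (A : set (borel (homspace H))) : \bar R :=
  \int[nu]_(x in A) (density theta x)%:E.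

Definition Theta : set ({scalar 'cV[R]_d} * (G -> R)) :=
  [set theta | W0 H theta.2 /\ p_tilde theta setT < +oo].

Definition p_theta theta (A : set (borel (homspace H))) : \bar R :=
  ((fine (p_tilde theta setT))^-1)%:E * p_tilde theta A.

Definition exponential_family : set (set (borel (homspace H)) -> \bar R) :=
  [set p_theta theta | theta in Theta].

End Family.

Local Close Scope ereal_scope.

Record SO (R : realType) (n : nat) := MkSO {
  so_mx :> 'M[R]_n ;
  so_mxP : (so_mx^T *m so_mx == 1%:M) && (\det so_mx == 1) }.

HB.instance Definition _ (R : realType) (n : nat) :=
  [isSub for @so_mx R n].
HB.instance Definition _ (R : realType) (n : nat) :=
  [Choice of SO R n by <:].
HB.instance Definition _ (R : realType) (n : nat) :=
  Topological.copy (SO R n) (initial_topology (@so_mx R n)).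

Lemma mx_continuous (R : realType) (T : topologicalType) m n
    (f : T -> 'M[R]_(m, n)) :
  (forall i j, continuous (fun x => f x i j)) -> continuous f.
Proof.
move=> fc x A [P] nP PA.
have : \forall y \near x, forall i j, P i j (f y i j).
  apply: filter_forall => i; apply: filter_forall => j.
  exact: (fc i j x (P i j) (nP i j)).
by apply: filterS => y Py; apply: PA.
Qed.

Section SOGroup.
Variables (R : realType) (n : nat).
Local Notation SO := (SO R n).
Implicit Types g h : SO.

Lemma so_trmxK g : (g : 'M[R]_n)^T *m g = 1%:M.
Proof. by case/andP: (so_mxP g) => /eqP. Qed.

Lemma so_mulmxV g : (g : 'M[R]_n) *m g^T = 1%:M.
Proof. by apply: mulmx1C; exact: so_trmxK. Qed.

Lemma so_det g : \det (g : 'M[R]_n) = 1.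
Proof. by case/andP: (so_mxP g) => _ /eqP. Qed.

Lemma so_one_subproof :
  ((1%:M : 'M[R]_n)^T *m 1%:M == 1%:M) && (\det (1%:M : 'M[R]_n) == 1).
Proof. by rewrite trmx1 mulmx1 det1 !eqxx. Qed.

Lemma so_mul_subproof g h :
  ((g *m h)^T *m (g *m h) == 1%:M) && (\det (g *m h) == 1).
Proof.
by rewrite trmx_mul mulmxA -(mulmxA _ _ (g : 'M[R]_n)) so_trmxK mulmx1 so_trmxK
  det_mulmx !so_det mulr1 !eqxx.
Qed.

Lemma so_inv_subproof g :
  ((g^T)^T *m g^T == 1%:M) && (\det (g^T) == 1).
Proof. by rewrite trmxK so_mulmxV det_tr so_det !eqxx. Qed.

Definition so_one : SO := MkSO so_one_subproof.
Definition so_mul g h : SO := MkSO (so_mul_subproof g h).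
Definition so_inv g : SO := MkSO (so_inv_subproof g).

Lemma so_mulA : associative so_mul.
Proof. by move=> x y z; apply: val_inj; rewrite /= mulmxA. Qed.
Lemma so_mul1g : left_id so_one so_mul.
Proof. by move=> x; apply: val_inj; rewrite /= mul1mx. Qed.
Lemma so_mulg1 : right_id so_one so_mul.
Proof. by move=> x; apply: val_inj; rewrite /= mulmx1. Qed.
Lemma so_mulVg : left_inverse so_one so_inv so_mul.
Proof. by move=> x; apply: val_inj; rewrite /= so_trmxK. Qed.
Lemma so_mulgV : right_inverse so_one so_inv so_mul.
Proof. by move=> x; apply: val_inj; rewrite /= so_mulmxV. Qed.

HB.instance Definition _ := isGroup.Build SO
  so_mulA so_mul1g so_mulg1 so_mulVg so_mulgV.
HB.instance Definition _ := isPointed.Build SO so_one.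

Lemma so_mx_continuous : continuous (@so_mx R n).
Proof. exact: initial_continuous. Qed.

Lemma so_coord_continuous i j : continuous (fun g : SO => g i j).
Proof.
move=> g; apply: (@continuous_comp _ _ _ (@so_mx R n) (fun A => A i j)).
  exact: so_mx_continuous.
exact: coord_continuous.
Qed.

Lemma so_mul_continuous : continuous (fun x : SO * SO => (x.1 * x.2)%g).
Proof.
apply: continuous_comp_initial; apply: mx_continuous => i j x.
rewrite (_ : (fun _ => _) =
  (fun x : SO * SO => \sum_k x.1 i k * x.2 k j)); last first.
  by apply/funext => y; rewrite /= mxE.
apply: cvg_big => [|k _]; first exact: add_continuous.
apply: cvgM.
  apply: (@continuous_comp _ _ _ fst (fun g : SO => g i k)).
    exact: cvg_fst.
  exact: so_coord_continuous.
apply: (@continuous_comp _ _ _ snd (fun g : SO => g k j)).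
  exact: cvg_snd.
exact: so_coord_continuous.
Qed.

Lemma so_inv_continuous : continuous (fun x : SO => (x^-1)%g).
Proof.
apply: continuous_comp_initial; apply: mx_continuous => i j x.
rewrite (_ : (fun _ => _) = (fun x : SO => x j i)); last first.
  by apply/funext => y; rewrite /= mxE.
exact: so_coord_continuous.
Qed.

HB.instance Definition _ := isTopologicalGroup.Build SO
  so_mul_continuous so_inv_continuous.

Definition so_natural_rep : continuousRep R SO n :=
  @ContinuousRep R SO n (@so_mx R n) erefl (fun _ _ => erefl) so_mx_continuous.

End SOGroup.

Section Stabilizer.
Variables (R : realType) (n : nat).

Definition so_block : set (SO R n.+1) :=
  [set g | exists k : SO R n,
     (g : 'M[R]_(1 + n)) = block_mx 1%:M 0 0 (k : 'M[R]_n)].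

Lemma so_block1 : so_block 1%g.
Proof. by exists 1%g; rewrite /= -scalar_mx_block. Qed.

Lemma so_blockM x y : so_block x -> so_block y -> so_block (x * y)%g.
Proof.
move=> [k xk] [l yl]; exists (k * l)%g; rewrite /= [LHS](congr2 mulmx xk yl).
by rewrite mulmx_block !mul0mx !mulmx0 !addr0 add0r mulmx1.
Qed.

Lemma so_blockV x : so_block x -> so_block (x^-1)%g.
Proof.
move=> [k xk]; exists (k^-1)%g; rewrite /= [LHS](congr1 trmx xk).
by rewrite tr_block_mx trmx1 !trmx0.
Qed.

Lemma so_blockE : so_block =
  \bigcap_(i in [set: 'I_n.+1])
    ([set g : SO R n.+1 | g i ord0 = (i == ord0)%:R] `&`
     [set g : SO R n.+1 | g ord0 i = (i == ord0)%:R]).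
Proof.
have l0 : lshift n (ord0 : 'I_1) = ord0 by apply: val_inj.
have lr j : (rshift 1 j == ord0 :> 'I_n.+1) = false by [].
apply/seteqP; split => [g [k gk] i _|g gP].
  have gE (a b : 'I_(1 + n)) : g a b = block_mx 1%:M 0 0 (k : 'M[R]_n) a b.
    by rewrite -gk.
  split => /=; rewrite gE -l0; case: (@split_ordP 1 n i) => j ->;
    rewrite ?block_mxEul ?block_mxEdl ?block_mxEur ?l0 ?lr ?mxE ?ord1 ?l0 //;
    by rewrite eqxx.
have gB : (g : 'M[R]_(1 + n)) =
    block_mx 1%:M 0 0 (drsubmx (g : 'M[R]_(1 + n))).
  rewrite -[LHS](submxK (g : 'M[R]_(1 + n))).
  congr block_mx; apply/matrixP => i j; rewrite !mxE ?ord1.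
  - by rewrite l0; have [/= -> _] := gP ord0 I.
  - by rewrite l0; have [_ /= ->] := gP (rshift 1 j) I.
  - by rewrite l0; have [/= -> _] := gP (rshift 1 i) I.
set k := drsubmx _ in gB.
have kP : (k^T *m k == 1%:M) && (\det k == 1).
  apply/andP; split.
    have : (block_mx 1%:M 0 0 k)^T *m block_mx 1%:M 0 0 k = 1%:M :> 'M[R]_(1 + n).
      by rewrite -gB; exact: so_trmxK.
    rewrite tr_block_mx mulmx_block trmx1 !trmx0 !mul0mx !mulmx0 !addr0 add0r mulmx1.
    by rewrite scalar_mx_block => /eq_block_mx[_ _ _ ->].
  have : \det (block_mx 1%:M 0 0 k : 'M[R]_(1 + n)) = 1.
    by rewrite -gB; exact: so_det.
  by rewrite det_ublock det1 mul1r => ->.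
by exists (MkSO kP).
Qed.

Lemma so_block_closed : closed so_block.
Proof.
rewrite so_blockE; apply: closed_bigI => i _; apply: closedI.
  apply: (@closed_comp _ _ (fun g : SO R n.+1 => g i ord0) [set (i == ord0)%:R]).
    by move=> g _; exact: so_coord_continuous.
  exact: closed_eq.
apply: (@closed_comp _ _ (fun g : SO R n.+1 => g ord0 i) [set (i == ord0)%:R]).
  by move=> g _; exact: so_coord_continuous.
exact: closed_eq.
Qed.

Definition so_stab : closedSubgroup (SO R n.+1) :=
  ClosedSubgroup so_block1 so_blockM so_blockV so_block_closed.

End Stabilizer.

Definition enorm (R : realType) (n : nat) (x : 'cV[R]_n) : R :=
  Num.sqrt (\sum_i x i 0 ^+ 2).

Definition e1 (R : realType) (n : nat) : 'cV[R]_n.+1 := delta_mx 0 0.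

(* [sphere R n] is the unit sphere of R^n. *)
Record sphere (R : realType) (n : nat) := MkSphere {
  sphere_vec :> 'cV[R]_n ;
  sphere_vecP : enorm sphere_vec == 1 }.

HB.instance Definition _ (R : realType) (n : nat) :=
  [isSub for @sphere_vec R n].
HB.instance Definition _ (R : realType) (n : nat) :=
  [Choice of sphere R n by <:].
HB.instance Definition _ (R : realType) (n : nat) :=
  Topological.copy (sphere R n) (initial_topology (@sphere_vec R n)).

Lemma enormE (R : realType) (n : nat) (x : 'cV[R]_n) :
  enorm x = Num.sqrt ((x^T *m x) 0 0).
Proof.
by rewrite /enorm mxE; congr Num.sqrt; apply: eq_bigr => i _; rewrite mxE expr2.
Qed.

Lemma enorm_e1 (R : realType) (n : nat) : enorm (e1 R n) == 1.
Proof. by rewrite enormE trmx_delta mul_delta_mx mxE sqrtr1. Qed.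

HB.instance Definition _ (R : realType) (n : nat) :=
  isPointed.Build (sphere R n.+1) (MkSphere (enorm_e1 R n)).

Section SphereAction.
Variables (R : realType) (n : nat).

Lemma so_act_subproof (g : SO R n) (x : sphere R n) :
  enorm ((g : 'M[R]_n) *m x) == 1.
Proof.
rewrite enormE trmx_mul mulmxA -(mulmxA _ _ (g : 'M[R]_n)) so_trmxK mulmx1.
by rewrite -enormE sphere_vecP.
Qed.

Definition so_act (g : SO R n) (x : sphere R n) : sphere R n :=
  MkSphere (so_act_subproof g x).

End SphereAction.

Definition coset_to_sphere (R : realType) (n : nat)
    (x : homspace (so_stab R n)) : sphere R n.+1 :=
  so_act (repr x) (MkSphere (enorm_e1 R n)).

Definition Gamma (R : realType) (s : R) : R :=
  \int[@lebesgue_measure R]_(t in `]0, +oo[) (t `^ (s - 1) * expR (- t)).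

Definition besselI (R : realType) (m r : R) : R :=
  limn (series (fun j : nat =>
    (j`!%:R * Gamma (j%:R + m + 1))^-1 * (r / 2) `^ (2 * j%:R + m))).

(* The measure dx: the rotation invariant Borel measure on the sphere S^{n-1}
   of R^n, where [n = n'.+1], with total mass 2 pi^{n/2} / Gamma (n/2). *)
Definition uniform_sphere_measure (R : realType) (n' : nat)
    (sigma : {measure set (borel (sphere R n'.+1)) -> \bar R}) : Prop :=
  let n : R := n'.+1%:R in
  (forall (g : SO R n'.+1) (A : set (borel (sphere R n'.+1))), measurable A ->
     pushforward sigma
       (so_act g : borel (sphere R n'.+1) -> borel (sphere R n'.+1)) A
     = sigma A) /\
  sigma setT = (2 * pi `^ (n / 2) / Gamma (n / 2))%:E.

Definition bessel_factor (R : realType) (n' : nat) (mu : 'cV[R]_n'.+1) : R :=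
  let n : R := n'.+1%:R in
  let f (v : 'cV[R]_n'.+1) :=
    enorm v `^ (1 - n / 2) * besselI (n / 2 - 1) (enorm v) in
  if mu == 0 then lim (f v @[v --> (0 : 'cV[R]_n'.+1)^']) else f mu.

Definition vMF (R : realType) (n' : nat)
    (sigma : {measure set (borel (sphere R n'.+1)) -> \bar R})
    (mu : 'cV[R]_n'.+1) (A : set (borel (sphere R n'.+1))) : \bar R :=
  let n : R := n'.+1%:R in
  ((((2 * pi) `^ (n / 2) * bessel_factor mu)^-1)%:E *
   \int[sigma]_(x in A)
     (expR (- (mu^T *m (x : sphere R n'.+1)) 0 0))%:E)%E.

(* Main.v *)
(* The sphere is a compact metric space on which SO(n) acts transitively by
   isometries. Normalized covering numbers, passed to the limit along an
   ultrafilter, give a rotation invariant Borel probability measure, and two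
   measures whose balls of equal radius have equal mass are proportional
   (Christensen). Hence every measure nu of the method has trivial multiplier
   and is a multiple of dx under SO(n)/SO(n-1) = S^(n-1); as SO(n) is compact,
   tau = 0, and p_theta is the measure with density proportional to exp(-mu.x).

   For the normalizing constant, rotation invariance gives
   int (mu.x)^k dx = |mu|^k a_k with a_k = 0 for odd k. Comparing the
   coefficients of t^2 in the moments of e_1 + t e_j and summing over j <> 1
   gives (2k+1) a_2k = (2k+n) a_(2k+2), which matches Gamma(s+1) = s Gamma(s) in
   the Bessel series. At mu = 0 the constant is obtained by continuity. *)
From HB Require Import structures.
Require Import Defs.
From mathcomp Require Import all_boot all_order all_algebra finmap.
From mathcomp Require Import all_classical all_reals all_analysis.
From mathcomp Require Import measurable_realfun ring lra.

Set Implicit Arguments.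
Unset Strict Implicit.
Unset Printing Implicit Defensive.

Import Order.TTheory GRing.Theory Num.Theory numFieldNormedType.Exports.
Local Open Scope classical_set_scope.
Local Open Scope ring_scope.

(** * Covering numbers of a compact metric space *)

(** The limit of the covering ratios is known to be additive only on sets at positive distance, so
    it is not yet a measure. Two regularisations repair this: from inside, over sets whose uniform
    neighbourhood stays in an open set, and from outside, over open supersets. Additivity at
    positive distance is exactly what Caratheodory's criterion for open sets asks for. Uniqueness is
    a Fubini argument for the neighbourhood [d x y < e] of the diagonal. Both arguments are carried
    out for a compact space whose topology comes from a distance function; rotations enter only
    afterwards, as isometries acting transitively. Transitivity also makes SO(n)/SO(n-1) -> S^(n-1)
    a continuous bijection from a compact to a Hausdorff space, hence a homeomorphism. This carries
    the measure found on the sphere back to the quotient, where it serves as [nu]. The moment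
    recursion determines all moments from the total mass, so the normalizing constant is found
    without parametrizing the sphere. *)

Section Covering.
Variables (R : realType) (T : ptopologicalType) (d : T -> T -> R).
Hypothesis dxx : forall x, d x x = 0.
Hypothesis dC : forall x y, d x y = d y x.
Hypothesis d_triangle : forall y x z, d x z <= d x y + d y z.
Hypothesis openP : forall U : set T, open U <->
  forall x, U x -> exists2 e : R, 0 < e & forall y, d x y < e -> U y.
Hypothesis cT : compact [set: T].

Definition dball (x : T) (e : R) : set T := [set y | d x y < e].

Lemma open_dball x e : open (dball x e).
Proof.
apply/openP => y; rewrite /dball/= => xy; exists (e - d x y); first by rewrite subr_gt0.
by move=> z yz; have := d_triangle y x z; lra.
Qed.

Definition covers (e : R) (A : set T) (s : seq T) : Prop :=
  forall x, A x -> exists2 c, c \in s & d c x < e.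

Lemma covers_exists e A : 0 < e -> exists s, covers e A s.
Proof.
move=> e0; move: cT; rewrite compact_cover.
have : forall i, [set: T] i -> open (dball i e) by move=> i _; exact: open_dball.
move=> /[swap] /[apply].
have : [set: T] `<=` cover [set: T] (fun i => dball i e).
  by move=> x _; exists x => //; rewrite /dball/= dxx.
move=> /[swap] /[apply] -[D _ D_cover]; exists (enum_fset D) => x _.
by have [c cD cx] := D_cover x I; exists c.
Qed.

(** The centres may lie outside [A]; this makes the number monotone in [A]. *)
Definition covnum (e : R) (A : set T) : R :=
  inf [set (size s)%:R | s in covers e A].

Lemma covnum_has_inf e A : 0 < e -> has_inf [set ((size s)%:R : R) | s in covers e A].
Proof.
move=> e0; split; first by have [s As] := covers_exists A e0; exists (size s)%:R, s.
by exists 0 => _ [s _ <-].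
Qed.

Lemma covnum_le e A s : 0 < e -> covers e A s -> covnum e A <= (size s)%:R.
Proof. by move=> e0 As; apply: ge_inf; [exact: (covnum_has_inf A e0).2|exists s]. Qed.

Lemma le_covnum e A r : 0 < e ->
  (forall s, covers e A s -> r <= (size s)%:R) -> r <= covnum e A.
Proof.
move=> e0 Ar; apply: lb_le_inf; first exact: (covnum_has_inf A e0).1.
by move=> _ [s As <-]; exact: Ar.
Qed.

Lemma covnum_ge0 e A : 0 < e -> 0 <= covnum e A.
Proof. by move=> e0; exact: le_covnum. Qed.

Lemma covnum_mono e A B : 0 < e -> A `<=` B -> covnum e A <= covnum e B.
Proof.
by move=> e0 AB; apply: le_covnum => // s Bs; apply: covnum_le => // x /AB /Bs.
Qed.

Lemma covnumU e A B : 0 < e -> covnum e (A `|` B) <= covnum e A + covnum e B.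
Proof.
move=> e0; rewrite -lerBlDr; apply: le_covnum => // s As.
rewrite lerBlDr addrC -lerBlDr; apply: le_covnum => // t Bt.
rewrite lerBlDr -natrD addnC -size_cat; apply: covnum_le => // x [/As|/Bt] [c cs cx];
  by exists c => //; rewrite mem_cat cs ?orbT.
Qed.

Lemma covnum_setT_ge1 e : 0 < e -> 1 <= covnum e [set: T].
Proof.
move=> e0; apply: le_covnum => // -[|c s] Ts; first by have [] := Ts point I.
by rewrite ler1n.
Qed.

(* An [e]-ball cannot meet both [A] and [B]. *)
Lemma covnum_separated e A B : 0 < e ->
  (forall x y, A x -> B y -> 2 * e <= d x y) ->
  covnum e A + covnum e B <= covnum e (A `|` B).
Proof.
move=> e0 AB; apply: le_covnum => // s ABs.
pose P c := `[< exists2 x, A x & d c x < e >].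
rewrite -(count_predC P) natrD -!size_filter; apply: lerD; apply: covnum_le => // x Xx.
- have [c cs cx] : exists2 c, c \in s & d c x < e by apply: ABs; left.
  by exists c => //; rewrite mem_filter cs andbT; apply/asboolP; exists x.
- have [c cs cx] : exists2 c, c \in s & d c x < e by apply: ABs; right.
  exists c => //; rewrite mem_filter cs andbT; apply/asboolP => -[y Ay cy].
  by have := AB _ _ Ay Xx; have := d_triangle c y x; rewrite (dC y c); lra.
Qed.

(** The images under [h] of the centres for [A] are centres for the preimage. *)
Lemma covnum_isometry e A (g h : T -> T) : 0 < e -> cancel h g ->
  (forall x y, d (g x) (g y) = d x y) -> covnum e (g @^-1` A) <= covnum e A.
Proof.
move=> e0 hK gd; apply: le_covnum => // s As; rewrite -(size_map h).
apply: covnum_le => // x /= /As [c cs cx]; exists (h c); first exact: map_f.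
by rewrite -gd hK.
Qed.

(* The limit of the covering ratios along a free ultrafilter. *)
Lemma separated_content_exists : exists lam : set T -> R,
  [/\ lam [set: T] = 1,
      forall A B, A `<=` B -> lam A <= lam B,
      forall A B, lam (A `|` B) <= lam A + lam B,
      forall A B e, 0 < e -> (forall x y, A x -> B y -> e <= d x y) ->
        lam A + lam B <= lam (A `|` B)
    & forall (g h : T -> T) A, cancel h g ->
        (forall x y, d (g x) (g y) = d x y) -> lam (g @^-1` A) <= lam A].
Proof.
pose r A (k : nat) : R := covnum k.+1%:R^-1 A / covnum k.+1%:R^-1 [set: T].
have e0 (k : nat) : 0 < k.+1%:R^-1 :> R by rewrite invr_gt0.
have T0 k : 0 < covnum k.+1%:R^-1 [set: T].
  by apply: lt_le_trans (covnum_setT_ge1 _).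
have le_r A B k : covnum k.+1%:R^-1 A <= covnum k.+1%:R^-1 B -> r A k <= r B k.
  by move=> AB; rewrite ler_pM2r// invr_gt0.
have [G [GU ooG]] := ultraFilterLemma eventually_filter.
have GF : ProperFilter G by exact: ultra_proper.
(* The ratios lie in [0, 1], and the image of an ultrafilter is an ultrafilter, so it converges in
   this compact interval. *)
have r_cvg A : exists l : R, r A @ G --> l.
  have UG : UltraFilter (r A @ G).
    split; first exact: fmap_proper_filter.
    move=> F FF GFs; apply/seteqP; split => // X FX.
    have [//|GX] := in_ultra_setVsetC (r A @^-1` X) GU.
    have : F (~` X) by apply: GFs.
    by move=> /(filterI FX); rewrite setICr => /filter_not_empty.
  have : compact `[(0 : R), 1] by exact: segment_compact.
  rewrite compact_ultra.
  move=> /(_ _ UG) [].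
    apply: ooG; exists 0%N => // k _ /=; rewrite in_itv/= ler_pdivrMr ?mul1r//.
    by rewrite divr_ge0 ?covnum_ge0//= covnum_mono.
  by move=> l [_ rl]; exists l.
pose lam A := lim (r A @ G).
have lamP A : r A @ G --> lam A by have [l rl] := r_cvg A; apply: cvgP rl.
exists lam; split.
- apply: cvg_lim => //; rewrite (_ : r _ = fun=> 1); first exact: cvg_cst.
  by apply/funext => k; rewrite /r divff// gt_eqF.
- move=> A B AB; apply: ler_cvg_to (lamP A) (lamP B) _.
  by apply: nearW => k; apply/le_r/covnum_mono.
- move=> A B; apply: ler_cvg_to (lamP _) (cvgD (lamP A) (lamP B)) _.
  by apply: nearW => k; rewrite /= -mulrDl ler_pM2r ?invr_gt0// covnumU.
- move=> A B e e_gt0 AB; apply: ler_cvg_to (cvgD (lamP A) (lamP B)) (lamP _) _.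
  (* At radius 1/(k+1) additivity needs the separation 2/(k+1); this holds for all large [k], and
     [G] contains the tails. *)
  have e2 : 0 < 2^-1 * e by rewrite mulr_gt0.
  apply: ooG; near=> k; rewrite /= -mulrDl ler_pM2r ?invr_gt0//.
  apply: covnum_separated => // x y Ax By; apply: le_trans (AB x y Ax By).
  rewrite -ler_pdivlMl// ltW//.
  by near: k; exact: (near_infty_natSinv_lt (PosNum e2)).
- move=> g h A hK gd; apply: ler_cvg_to (lamP _) (lamP _) _.
  by apply: nearW => k; apply/le_r/(covnum_isometry _ _ hK).
Unshelve. all: by end_near. Qed.

End Covering.

(** * The invariant measure of a compact metric space *)

Section ContentMeasure.
Variables (R : realType) (T : ptopologicalType) (d : T -> T -> R).
Hypothesis dxx : forall x, d x x = 0.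
Hypothesis dC : forall x y, d x y = d y x.
Hypothesis d_triangle : forall y x z, d x z <= d x y + d y z.
Hypothesis openP : forall U : set T, open U <->
  forall x, U x -> exists2 e : R, 0 < e & forall y, d x y < e -> U y.
Hypothesis cT : compact [set: T].
Variable lam : set T -> R.
Hypothesis lamT : lam [set: T] = 1.
Hypothesis lam_mono : forall A B, A `<=` B -> lam A <= lam B.
Hypothesis lamU : forall A B, lam (A `|` B) <= lam A + lam B.
Hypothesis lam_separated : forall A B e, 0 < e ->
  (forall x y, A x -> B y -> e <= d x y) -> lam A + lam B <= lam (A `|` B).

(** Stands in for a compact set inside an open one: the inclusion has a uniform margin, while [K]
    can be any set, as [lam] is defined on all of them. *)
Definition well_inside (K U : set T) : Prop :=
  exists2 e, 0 < e & forall x y, K x -> d x y < e -> U y.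

Lemma well_inside_subset K U : well_inside K U -> K `<=` U.
Proof. by move=> [e e0 KU] x Kx; apply: (KU x) => //; rewrite dxx. Qed.

Lemma well_inside_closure K U : well_inside K U -> closure K `<=` U.
Proof.
move=> [e e0 KU] x Kx.
have [|y [Ky xy]] := Kx (dball d x e).
  apply: open_nbhs_nbhs; split; first exact: (open_dball d_triangle openP).
  by rewrite /dball/= dxx.
by apply: (KU y) => //; rewrite dC.
Qed.

Lemma well_insideU K L U : well_inside K U -> well_inside L U ->
  well_inside (K `|` L) U.
Proof.
move=> [e e0 KU] [f f0 LU]; exists (Num.min e f); first by rewrite lt_min e0.
by move=> x y [/KU|/LU] xU; rewrite lt_min => /andP[xye xyf]; exact: xU.
Qed.

(** The empty set is vacuously at positive distance from itself, so [lam] is both superadditive and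
    subadditive on two copies of it. *)
Lemma lam0 : lam set0 = 0.
Proof.
apply/eqP; rewrite eq_le; apply/andP; split.
  have := @lam_separated set0 set0 1 ltr01 (fun x y => False_ind _).
  by rewrite setU0; lra.
by have := lamU set0 set0; rewrite setU0; lra.
Qed.

Local Open Scope ereal_scope.

(** [lam] is only finitely subadditive. The supremum over sets with a uniform margin becomes
    countably subadditive on open sets, by compactness. *)
Definition inner_content (U : set T) : \bar R :=
  ereal_sup [set (lam K)%:E | K in [set K | well_inside K U]].

Definition content_measure (A : set T) : \bar R :=
  ereal_inf [set inner_content U | U in [set U | open U /\ A `<=` U]].

Lemma le_inner_content K U : well_inside K U -> (lam K)%:E <= inner_content U.
Proof. by move=> KU; apply: ereal_sup_ubound; exists K. Qed.

Lemma inner_content_le U x : (forall K, well_inside K U -> (lam K)%:E <= x) ->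
  inner_content U <= x.
Proof. by move=> Ux; apply: ge_ereal_sup => _ [K KU <-]; exact: Ux. Qed.

Lemma inner_content_mono U V : U `<=` V -> inner_content U <= inner_content V.
Proof.
move=> UV; apply: inner_content_le => K [e e0 KU]; apply: le_inner_content.
by exists e => // x y Kx xy; exact/UV/(KU x).
Qed.

Lemma inner_content_ge0 U : 0 <= inner_content U.
Proof.
by apply: (@le_trans _ _ (lam set0)%:E);
  [rewrite lam0|apply: le_inner_content; exists 1%R].
Qed.

Lemma inner_content_setT : inner_content [set: T] = 1.
Proof.
apply/eqP; rewrite eq_le; apply/andP; split.
  by apply: inner_content_le => K _; rewrite lee_fin -lamT lam_mono.
by rewrite -lamT; apply: le_inner_content; exists 1%R.
Qed.

Lemma lam_bigsetU (K : nat -> set T) n :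
  (lam (\bigcup_(i < n) K i) <= \sum_(i < n) lam (K i))%R.
Proof.
elim: n => [|n IH]; first by rewrite big_ord0 bigcup_mkord big_ord0 lam0.
rewrite bigcup_mkord !big_ord_recr/= -bigcup_mkord.
by apply: le_trans (lamU _ _) _; rewrite lerD2r.
Qed.

(* A Lebesgue number for the cover of the closure of [K] by the [U i]. *)
Lemma closure_bigcup_lebesgue K (U : nat -> set T) : (forall i, open (U i)) ->
  closure K `<=` \bigcup_i U i ->
  exists n (e : R), (0 < e)%R /\ forall x, K x ->
    exists2 i, (i < n)%N & forall y, (d x y < e)%R -> U i y.
Proof.
move=> oU KU.
(* Near covering is applied to all of [T]. A point off [closure K] has a neighbourhood missing [K],
   where the implication is void; at a point of [closure K], half the radius of a ball inside some
   [U i] works. *)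
have /compact_near_coveringP/(_ nat \oo (fun n x => K x ->
    exists2 i, (i < n)%N & forall y, (d x y < n.+1%:R^-1)%R -> U i y)) := cT.
move=> /(_ _)[].
- move=> x _; have [xK|xK] := pselect (closure K x); last first.
    near=> x' n => /= Kx'; exfalso.
    suff : (~` closure K) x' by apply; exact: subset_closure.
    near: x'; apply: open_nbhs_nbhs; split => //.
    by apply: closed_openC; exact: closed_closure.
  have [i _ Uix] := KU _ xK; have [f f0 fU] := (openP (U i)).1 (oU i) x Uix.
  have f2 : (0 < f / 2)%R by rewrite divr_gt0.
  near=> x' n => /= Kx'; exists i.
    by near: n; exists i.+1.
  move=> z x'z; apply: fU; apply: le_lt_trans (d_triangle x' _ _) _.
  rewrite (splitr f); apply: ltrD.
    near: x'; apply: open_nbhs_nbhs; split; first exact: (open_dball d_triangle openP).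
    by rewrite /dball/= dxx.
  apply: lt_trans x'z _.
  by near: n; exact: (near_infty_natSinv_lt (PosNum f2)).
- move=> n _ /(_ n (leqnn n)) nP; exists n, n.+1%:R^-1%R; split.
    by rewrite invr_gt0.
  by move=> x Kx; exact: nP.
Unshelve. all: by end_near. Qed.

(** A Lebesgue number of the constant cover by [U] is the margin. *)
Lemma closure_well_inside K U : open U -> closure K `<=` U -> well_inside K U.
Proof.
move=> oU KU; have [|n [e [e0 Ke]]] := @closure_bigcup_lebesgue K (fun=> U) (fun=> oU).
  by move=> x /KU Ux; exists 0%N.
by exists e => // x y /Ke[i _]; apply.
Qed.

(** A Lebesgue number [e] cuts [K] into finitely many pieces [L i], the points whose [e]-ball lies
    in [U i]. Each piece is well inside its [U i], so finite subadditivity of [lam] suffices. *)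
Lemma inner_content_bigcup (U : nat -> set T) : (forall i, open (U i)) ->
  inner_content (\bigcup_i U i) <= \sum_(i <oo) inner_content (U i).
Proof.
move=> oU; apply: inner_content_le => K.
move=> /well_inside_closure/(closure_bigcup_lebesgue oU)[n [e [e0 Ke]]].
pose L i := [set x | K x /\ forall y, (d x y < e)%R -> U i y].
have KL : K `<=` \bigcup_(i < n) L i.
  by move=> x Kx; have [i ni iU] := Ke x Kx; exists i.
apply: (@le_trans _ _ (\sum_(0 <= i < n) inner_content (U i))).
  apply: (@le_trans _ _ (\sum_(i < n) (lam (L i))%:E)).
    by rewrite sumEFin lee_fin; apply: le_trans (lam_mono KL) (lam_bigsetU _ _).
  rewrite big_mkord; apply: lee_sum => i _; apply: le_inner_content.
  by exists e => // x y [_]; apply.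
by apply: nneseries_lim_ge => i _ _; exact: inner_content_ge0.
Qed.

Lemma content_measure_ge0 A : 0 <= content_measure A.
Proof. by apply: le_ereal_inf_tmp => _ [U _ <-]; exact: inner_content_ge0. Qed.

Lemma content_measure_le U A : open U -> A `<=` U ->
  content_measure A <= inner_content U.
Proof. by move=> oU AU; apply: ereal_inf_lbound; exists U. Qed.

Lemma content_measure_open U : open U -> content_measure U = inner_content U.
Proof.
move=> oU; apply/eqP; rewrite eq_le content_measure_le//=.
by apply: le_ereal_inf_tmp => _ [V [_ UV] <-]; exact: inner_content_mono.
Qed.

Lemma content_measure0 : content_measure set0 = 0.
Proof.
rewrite content_measure_open; last exact: open0.
apply/eqP; rewrite eq_le inner_content_ge0 andbT; apply: inner_content_le => K.
by move=> /well_inside_subset K0; rewrite lee_fin -lam0 lam_mono.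
Qed.

Lemma content_measure_mono A B : A `<=` B -> content_measure A <= content_measure B.
Proof.
move=> AB; apply: le_ereal_inf_tmp => _ [U [oU BU] <-].
by apply: content_measure_le => //; exact: subset_trans BU.
Qed.

Lemma content_measure_fin A : content_measure A \is a fin_num.
Proof.
rewrite ge0_fin_numE ?content_measure_ge0//.
apply: le_lt_trans (ltry 1); rewrite -inner_content_setT -content_measure_open.
  exact: content_measure_mono.
exact: openT.
Qed.

Lemma content_measure_sigma_subadditive : sigma_subadditive content_measure.
Proof.
move=> A; apply/lee_addgt0Pr => e e0.
apply: le_trans (epsilon_trick xpredT (fun n => content_measure_ge0 (A n)) (ltW e0)).
have /choice[U UP] : forall i, exists U, [/\ open U, A i `<=` U &
    inner_content U <= content_measure (A i) + (e / (2 ^ i.+1)%:R)%:E].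
  move=> i; have e2 : (0 < e / (2 ^ i.+1)%:R)%R by rewrite divr_gt0// ltr0n expn_gt0.
  have [_ [U [oU AU] <-] Ue] := lb_ereal_inf_adherent e2 (content_measure_fin (A i)).
  by exists U; split => //; exact: ltW.
apply: (@le_trans _ _ (\sum_(i <oo) inner_content (U i))); last first.
  by apply: lee_nneseries => i *; [exact: inner_content_ge0|have [] := UP i].
apply: le_trans (inner_content_bigcup _); last by move=> i; have [] := UP i.
apply: content_measure_le; first by apply: bigcup_open => i _; have [] := UP i.
by apply: subset_bigcup => i _; have [] := UP i.
Qed.

HB.instance Definition _ := isOuterMeasure.Build R T content_measure
  content_measure0 content_measure_ge0 content_measure_mono
  content_measure_sigma_subadditive.

(** For an open [V] around [X], fix [K] well inside [V] and [U]. Any [L] well inside the rest of [V]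
    outside [closure K] keeps a positive distance from [K], so [lam K + lam L] is at most the
    content of [V]. Suprema over [L], then over [K], give the criterion, as that rest contains the
    part of [X] outside [U]. *)
Lemma open_caratheodory U : open U -> content_measure.-caratheodory U.
Proof.
move=> oU; apply: le_caratheodory_measurable => X.
apply: le_ereal_inf_tmp => _ [V [oV XV] <-].
apply: (@le_trans _ _ (inner_content (V `&` U) + content_measure (X `&` ~` U))).
  by rewrite leeD2r// content_measure_le//; [exact: openI|exact: setSI].
rewrite -leeBrDr ?content_measure_fin//; apply: inner_content_le => K KVU.
rewrite leeBrDr ?content_measure_fin// addeC -leeBrDr//.
apply: le_trans (_ : _ <= inner_content (V `\` closure K)) _.
  apply: content_measure_le.
    by apply: openI => //; apply: closed_openC; exact: closed_closure.
  move=> x [Xx Ux]; split; first exact: XV.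
  by move/(well_inside_closure KVU) => [].
apply: inner_content_le => L [e e0 LV]; rewrite leeBrDr// -EFinD addrC.
apply: (@le_trans _ _ (lam (K `|` L))%:E).
  rewrite lee_fin; apply: (lam_separated e0) => x y Kx Ly.
  rewrite leNgt; apply/negP; rewrite dC => /(LV y x Ly)[_]; apply.
  exact: subset_closure.
apply: le_inner_content; apply: well_insideU.
  by have [f f0 KV] := KVU; exists f => // x y Kx /(KV x y Kx)[].
by exists e => // x y Lx /(LV x y Lx)[].
Qed.

Lemma borel_caratheodory (A : set (borel T)) : measurable A ->
  content_measure.-caratheodory A.
Proof.
move: A; apply: smallest_sub => [|U oU]; last exact: open_caratheodory.
split; first exact: caratheodory_measurable_set0.
  by move=> A mA; rewrite setTD; exact: caratheodory_measurable_setC.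
by move=> F mF; exact: caratheodory_measurable_bigcup.
Qed.

Let mu : set (borel T) -> \bar R := content_measure.

Let mu_semi_sigma_additive : semi_sigma_additive mu.
Proof.
move=> F mF tF mUF; apply: (@caratheodory_measure_sigma_additive _ _ content_measure) => //.
  by move=> i; exact: borel_caratheodory.
exact: borel_caratheodory.
Qed.

HB.instance Definition _ := isMeasure.Build _ _ _ mu content_measure0
  content_measure_ge0 mu_semi_sigma_additive.

Lemma content_measure_exists : exists m : {measure set (borel T) -> \bar R},
  m = content_measure :> (set T -> \bar R).
Proof. by exists mu. Qed.

(** Outer regularity is built in. For inner regularity, [closure K] is compact and still inside [U],
    and its measure is at least [lam K] because [K] is well inside every open set containing
    [closure K]. *)
Lemma content_measure_radon (m : {measure set (borel T) -> \bar R}) :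
  m = content_measure :> (set T -> \bar R) -> radon m.
Proof.
move=> mE; split => [K _|A _|U oU].
- by rewrite mE -ge0_fin_numE ?content_measure_ge0 ?content_measure_fin.
- rewrite mE; congr ereal_inf; apply/seteqP; split => _ [V [oV AV] <-];
    by exists V => //; rewrite ?mE content_measure_open.
- apply/eqP; rewrite eq_le; apply/andP; split; last first.
    apply: ge_ereal_sup => _ [K [_ KU] <-].
    by rewrite mE; exact: content_measure_mono.
  rewrite mE content_measure_open//; apply: inner_content_le => K KU.
  apply: (@le_trans _ _ (m (closure K))).
    rewrite mE; apply: le_ereal_inf_tmp => _ [V [oV KV] <-].
    exact/le_inner_content/closure_well_inside.
  apply: ereal_sup_ubound; exists (closure K); last by rewrite mE.
  split.
    by apply: (subclosed_compact _ cT) => //; exact: closed_closure.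
  exact: well_inside_closure.
Qed.

End ContentMeasure.

Section InvariantMeasure.
Variables (R : realType) (T : ptopologicalType) (d : T -> T -> R).
Hypothesis dxx : forall x, d x x = 0.
Hypothesis dC : forall x y, d x y = d y x.
Hypothesis d_triangle : forall y x z, d x z <= d x y + d y z.
Hypothesis openP : forall U : set T, open U <->
  forall x, U x -> exists2 e : R, 0 < e & forall y, d x y < e -> U y.
Hypothesis cT : compact [set: T].

(** A set [K] well inside the preimage of [U] is the preimage under [g] of its own image, and that
    image, written as a preimage under [h], is well inside [U] with the same margin. *)
Lemma content_measure_isometry_le (lam : set T -> R) (g h : T -> T) A :
  (forall (g h : T -> T) A, cancel h g ->
    (forall x y, d (g x) (g y) = d x y) -> lam (g @^-1` A) <= lam A) ->
  cancel g h -> cancel h g -> (forall x y, d (g x) (g y) = d x y) ->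
  (content_measure d lam (g @^-1` A) <= content_measure d lam A)%E.
Proof.
move=> lam_iso gK hK gd; have hd x y : d (h x) (h y) = d x y by rewrite -gd !hK.
apply: le_ereal_inf_tmp => _ [U [oU AU] <-].
apply: (@le_trans _ _ (inner_content d lam (g @^-1` U))).
  apply: content_measure_le; last by move=> x /AU.
  apply/openP => x Ux; have [e e0 eU] := (openP U).1 oU (g x) Ux.
  by exists e => // y xy; apply: eU; rewrite gd.
apply: inner_content_le => K [e e0 KU].
apply: (@le_trans _ _ (lam (h @^-1` K))%:E).
  rewrite lee_fin [X in lam X <= _](_ : K = g @^-1` (h @^-1` K)); first exact: lam_iso hK gd.
  by apply/seteqP; split => x; rewrite /= gK.
apply: le_inner_content; exists e => // x y Kx xy.
by rewrite -[y]hK; apply: (KU (h x)) => //; rewrite hd.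
Qed.

Theorem isometry_invariant_measure : exists m : {measure set (borel T) -> \bar R},
  [/\ m [set: T] = 1%E, radon m
    & forall (g h : T -> T) A, cancel g h -> cancel h g ->
        (forall x y, d (g x) (g y) = d x y) -> m (g @^-1` A) = m A].
Proof.
have [lam [lamT lam_mono lamU lam_sep lam_iso]] :=
  separated_content_exists dxx dC d_triangle openP cT.
have [m mE] := content_measure_exists dxx dC d_triangle openP cT lamT lam_mono lamU lam_sep.
exists m; split.
- rewrite mE content_measure_open//; last exact: openT.
  exact: inner_content_setT.
- exact: content_measure_radon mE.
- move=> g h A gK hK gd; rewrite mE; apply/eqP; rewrite eq_le.
  rewrite (content_measure_isometry_le _ lam_iso gK hK)//=.
  (* The reverse inequality is the same bound for the inverse isometry [h]. *)
  have hd x y : d (h x) (h y) = d x y by rewrite -gd !hK.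
  rewrite [X in (content_measure _ _ X <= _)%E](_ : A = h @^-1` (g @^-1` A)).
    exact: (content_measure_isometry_le _ lam_iso hK gK).
  by apply/seteqP; split => x; rewrite /= hK.
Qed.

End InvariantMeasure.

(** * Uniqueness of uniformly distributed measures (Christensen) *)

Section UniformlyDistributed.
Variables (R : realType) (T : ptopologicalType) (d : T -> T -> R).
Hypothesis dxx : forall x, d x x = 0.
Hypothesis dC : forall x y, d x y = d y x.
Hypothesis d_triangle : forall y x z, d x z <= d x y + d y z.
Hypothesis openP : forall U : set T, open U <->
  forall x, U x -> exists2 e : R, 0 < e & forall y, d x y < e -> U y.
Hypothesis cT : compact [set: T].
(** The sigma-algebra is the product of the two Borel ones, the one carrying the product measure;
    for the sphere this is checked in coordinates. *)
Hypothesis d_measurable :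
  measurable_fun [set: borel T * borel T] (fun z => d z.1 z.2).
Local Open Scope ereal_scope.

Definition uniformly_distributed (m : set (borel T) -> \bar R) : Prop :=
  forall x y e, m (dball d x e) = m (dball d y e).

Lemma open_borel (U : set T) : open U -> measurable (U : set (borel T)).
Proof. exact: sub_sigma_algebra. Qed.

Let mdball x e : measurable (dball d x e : set (borel T)).
Proof. by apply: open_borel; exact: (open_dball d_triangle openP). Qed.

(** Finitely many balls of radius [e] cover [T] and all have the same mass; if one were null, so
    would be [T]. *)
Lemma uniformly_distributed_dball_gt0 (m : {measure set (borel T) -> \bar R}) x e :
  uniformly_distributed m -> m setT != 0 -> (0 < e)%R -> 0 < m (dball d x e).
Proof.
move=> mu mT e0; rewrite lt0e measure_ge0 andbT; apply: contra_neq mT => mx.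
have [s sT] := covers_exists dxx d_triangle openP cT [set: T] e0.
suff ms : m (\big[setU/set0]_(c <- s) (dball d c e : set (borel T))) = 0.
  apply/eqP; rewrite eq_le measure_ge0 andbT -{}ms.
  apply: le_measure; rewrite ?inE//; first by apply: bigsetU_measurable => c _.
  move=> y _; have [c cs cy] := sT y I.
  by rewrite -bigcup_seq; exists c.
elim: s {sT} => [|c s IH]; first by rewrite big_nil measure0.
rewrite big_cons; apply/eqP; rewrite eq_le measure_ge0 andbT.
apply: le_trans (measureU2 _ _ _) _ => //; first by apply: bigsetU_measurable => ? _.
by rewrite [X in X + _](etrans (mu c x e) mx) [X in _ + X]IH adde0.
Qed.

Section Pair.
Variables m1 m2 : {finite_measure set (borel T) -> \bar R}.
Hypothesis um1 : uniformly_distributed m1.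
Hypothesis um2 : uniformly_distributed m2.

Let near_diag e : set (borel T * borel T) := [set z | (d z.1 z.2 < e)%R].

Let measurable_near_diag e : measurable (near_diag e).
Proof.
have := d_measurable measurableT (measurable_itv `]-oo, e[).
by rewrite setTI; congr measurable; apply/seteqP; split => z; rewrite /= in_itv.
Qed.

(** The section over [x] is the ball about [x], whose [m2]-mass is the same for all [x], so the
    integral over [A] is that of a constant. *)
Let product_near_diag1 e (A : set (borel T)) : measurable A ->
  (m1 \x m2) (near_diag e `&` A `*` setT) = m2 (dball d point e) * m1 A.
Proof.
move=> mA; rewrite /product_measure1.
under eq_integral => x _.
  rewrite /= (_ : m2 _ = m2 (dball d point e) * (\1_A x)%:E); last first.
    rewrite indicE; have [xA|xA] := boolP (x \in A).
      rewrite mule1 (um2 point x); congr (m2 _); apply/seteqP; split => y.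
        by rewrite xsectionE => -[].
      by rewrite xsectionE => xy; split => //; split => //; exact: set_mem.
    rewrite mule0 (_ : xsection _ _ = set0) ?measure0//.
    apply/seteqP; split => y //; rewrite xsectionE => -[_ [/= Ax _]].
    by move: xA; rewrite mem_set.
  over.
rewrite ge0_integralZl//; last exact/measurable_EFinP/measurable_indic.
by rewrite integral_indic// setIT.
Qed.

Let product_near_diag2 e (A : set (borel T)) : measurable A ->
  (m1 \x m2) (near_diag e `&` setT `*` A) = m1 (dball d point e) * m2 A.
Proof.
(* Fubini: the same product measure by sections in the other variable, which are balls for [m1]. *)
move=> mA; transitivity ((m1 \x^ m2) (near_diag e `&` setT `*` A)).
  apply: product_measure_unique; last first.
    by apply: measurableI => //; exact: measurableX.
  by move=> B C mB mC; rewrite /= product_measure2E.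
rewrite /product_measure2.
under eq_integral => x _.
  rewrite /= (_ : m1 _ = m1 (dball d point e) * (\1_A x)%:E); last first.
    rewrite indicE; have [xA|xA] := boolP (x \in A).
      rewrite mule1 (um1 point x); congr (m1 _); apply/seteqP; split => y.
        by rewrite ysectionE /dball/= dC => -[].
      by rewrite ysectionE /dball/= dC => xy; split => //; split => //; exact: set_mem.
    rewrite mule0 (_ : ysection _ _ = set0) ?measure0//.
    apply/seteqP; split => y //; rewrite ysectionE => -[_ [/= _ Ax]].
    by move: xA; rewrite mem_set.
  over.
rewrite ge0_integralZl//; last exact/measurable_EFinP/measurable_indic.
by rewrite integral_indic// setIT.
Qed.

Let shrink (U : set T) e : set T := [set x | dball d x e `<=` U].

Let closed_shrink U e : closed (shrink U e).
Proof.
rewrite -[shrink U e]setCK; apply: open_closedC; apply/openP => x /existsNP[y].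
move=> /not_implyP[xy Uy]; exists (e - d x y)%R; first by rewrite subr_gt0.
move=> z xz zU; apply: Uy; apply: zU; rewrite /dball/=.
by have := d_triangle x z y; rewrite (dC z x); move: xy; rewrite /dball/=; lra.
Qed.

Let measurable_shrink U e : measurable (shrink U e : set (borel T)).
Proof.
rewrite -[shrink U e]setCK; apply: measurableC; apply: open_borel.
by apply: closed_openC; exact: closed_shrink.
Qed.

(* Compute the product measure of [d x y < e] with [x] in [shrink U e] by sections
   in [y], and bound it by that with [y] in [U] by sections in [x]. *)
Lemma uniformly_distributed_open_le U : open U -> m2 setT != 0 ->
  m2 setT * m1 U <= m1 setT * m2 U.
Proof.
move=> oU m2T.
have mU : measurable (U : set (borel T)) by exact: open_borel.
have shrink_le e : (0 < e)%R -> m2 setT * m1 (shrink U e) <= m1 setT * m2 U.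
  move=> e0; have c2 : 0 < m2 (dball d point e).
    exact: uniformly_distributed_dball_gt0.
  have c2fin : m2 (dball d point e) \is a fin_num by exact: fin_num_measure.
  (* Multiply by the positive finite mass of an [m2]-ball. The ratio of the ball masses of [m1] and
     [m2] is unknown; it is eliminated by evaluating the whole neighbourhood of the diagonal in both
     orders. What remains is an inclusion: if [x] is in [shrink U e] and [d x y < e], then [y] is in
     [U]. *)
  rewrite -(@lee_pmul2l _ (m2 (dball d point e)))// muleCA -product_near_diag1//.
  rewrite muleA -product_near_diag1// setXTT setIT.
  have := product_near_diag2 e measurableT; rewrite setXTT setIT => ->.
  rewrite (muleC (m1 _)) -muleA -product_near_diag2//.
  apply: lee_wpmul2l => //; apply: le_measure; rewrite ?inE.
  - by apply: measurableI => //; apply: measurableX => //; exact: measurable_shrink.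
  - by apply: measurableI => //; apply: measurableX.
  by move=> z [zd [/= z1 _]]; split => //; split => //=; exact: z1.
have shrinkU : \bigcup_n shrink U n.+1%:R^-1 = U.
  apply/seteqP; split => x.
    by move=> [n _]; apply; rewrite /dball/= dxx invr_gt0.
  move=> Ux; have [e e0 eU] := (openP U).1 oU x Ux.
  near \oo => n; exists n => // y; rewrite /dball/= => xy; apply: eU.
  apply: lt_trans xy _; near: n; exact: (near_infty_natSinv_lt (PosNum e0)).
have shrink_cvg : m2 setT * m1 (shrink U n.+1%:R^-1) @[n --> \oo] --> m2 setT * m1 U.
  apply: cvgeZl; first exact: fin_num_measure.
  rewrite -[in m1 U]shrinkU; apply: nondecreasing_cvg_mu.
  - by move=> n; exact: measurable_shrink.
  - by apply: bigcup_measurable => n _; exact: measurable_shrink.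
  - move=> n k nk; apply/subsetPset => x nU y xy; apply: nU.
    by apply: lt_le_trans xy _; rewrite lef_pV2 ?posrE// ler_nat.
rewrite -(cvg_lim _ shrink_cvg)//; apply: lime_le; first exact: cvgP shrink_cvg.
by apply: nearW => n; apply: shrink_le; rewrite invr_gt0.
Unshelve. all: by end_near. Qed.

End Pair.

(** The bound on open sets can be read with the two measures exchanged, which gives equality on open
    sets, a generating family stable under intersection. *)
Theorem uniformly_distributed_proportional
    (m1 m2 : {finite_measure set (borel T) -> \bar R}) (A : set (borel T)) :
  uniformly_distributed m1 -> uniformly_distributed m2 -> measurable A ->
  m2 setT * m1 A = m1 setT * m2 A.
Proof.
move=> um1 um2 mA.
have null (m : {finite_measure set (borel T) -> \bar R}) : m setT = 0 -> m A = 0.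
  by move=> mT; apply/eqP; rewrite -measure_le0 -mT le_measure ?inE.
have [m1T|m1T] := eqVneq (m1 setT) 0; first by rewrite m1T (null m1 m1T) mule0 mul0e.
have [m2T|m2T] := eqVneq (m2 setT) 0; first by rewrite m2T (null m2 m2T) mule0 mul0e.
have m1fin : (0 <= fine (m1 setT))%R by rewrite fine_ge0.
have m2fin : (0 <= fine (m2 setT))%R by rewrite fine_ge0.
have E (m m' : {finite_measure set (borel T) -> \bar R}) (p : (0 <= fine (m setT))%R) B :
    mscale (NngNum p) m' B = m setT * m' B.
  by rewrite /mscale/= fineK// fin_num_measure.
rewrite -(E m2 m1 m2fin) -(E m1 m2 m1fin).
apply: (@measure_unique _ _ (borel T) (@open T) (fun=> setT) _ _ _ _
  (mscale (NngNum m2fin) m1) (mscale (NngNum m1fin) m2)) => //.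
- by move=> U V; exact: openI.
- by move=> _; exact: openT.
- by apply/seteqP; split => // x _; exists 0%N.
- move=> U oU; rewrite [LHS](E m2 m1) [RHS](E m1 m2); apply/eqP; rewrite eq_le.
  by rewrite !uniformly_distributed_open_le.
- by move=> _; rewrite [X in X < _](E m2 m1) -ge0_fin_numE ?mule_ge0// fin_numM// fin_num_measure.
Qed.

End UniformlyDistributed.

(** * Euclidean geometry and transitivity of SO(n) *)

Section EuclideanNorm.
Variables (R : realType) (n : nat).
Implicit Types u v w : 'cV[R]_n.

Lemma enorm_ge0 u : 0 <= enorm u.
Proof. exact: sqrtr_ge0. Qed.

Lemma sqr_enorm u : enorm u ^+ 2 = \sum_i u i 0 ^+ 2.
Proof. by rewrite sqr_sqrtr// sumr_ge0// => i _; exact: sqr_ge0. Qed.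

Lemma sqr_enormE u : enorm u ^+ 2 = (u^T *m u) 0 0.
Proof. by rewrite sqr_enorm mxE; apply: eq_bigr => i _; rewrite mxE expr2. Qed.

Lemma enorm0 : enorm (0 : 'cV[R]_n) = 0.
Proof. by rewrite /enorm big1 ?sqrtr0// => i _; rewrite mxE expr0n. Qed.

Lemma enorm_eq0 u : enorm u = 0 -> u = 0.
Proof.
move=> u0; have : \sum_i u i 0 ^+ 2 = 0 by rewrite -sqr_enorm u0 expr0n.
move=> /psumr_eq0P => u2; apply/matrixP => i j; rewrite ord1 mxE.
by apply/eqP; rewrite -sqrf_eq0; apply/eqP/u2 => // k _; exact: sqr_ge0.
Qed.

Lemma enormN u : enorm (- u) = enorm u.
Proof. by congr Num.sqrt; apply: eq_bigr => i _; rewrite mxE sqrrN. Qed.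

Lemma enormZ a u : 0 <= a -> enorm (a *: u) = a * enorm u.
Proof.
move=> a0; rewrite /enorm -[a in RHS]ger0_norm// -sqrtr_sqr -sqrtrM ?sqr_ge0//.
by congr Num.sqrt; rewrite mulr_sumr; apply: eq_bigr => i _; rewrite mxE exprMn.
Qed.

Lemma coord_le_enorm u i : `|u i 0| <= enorm u.
Proof.
rewrite -(ler_pXn2r (n := 2))// ?nnegrE ?enorm_ge0// sqr_enorm real_normK ?num_real//.
by rewrite (bigD1 i)//= lerDl sumr_ge0// => k _; exact: sqr_ge0.
Qed.

Lemma dotE u v : (u^T *m v) 0 0 = \sum_i u i 0 * v i 0.
Proof. by rewrite mxE; apply: eq_bigr => i _; rewrite mxE. Qed.

Lemma dotC u v : (u^T *m v) 0 0 = (v^T *m u) 0 0.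
Proof. by rewrite !dotE; apply: eq_bigr => i _; rewrite mulrC. Qed.

Lemma dotZ a b u v : ((a *: u)^T *m (b *: v)) 0 0 = a * b * (u^T *m v) 0 0.
Proof. by rewrite !dotE mulr_sumr; apply: eq_bigr => i _; rewrite !mxE mulrACA. Qed.

Lemma sqr_enormD u v :
  enorm (u + v) ^+ 2 = enorm u ^+ 2 + 2 * (u^T *m v) 0 0 + enorm v ^+ 2.
Proof.
rewrite !sqr_enorm dotE mulr_sumr -!big_split /=.
by apply: eq_bigr => i _; rewrite mxE; ring.
Qed.

Lemma Cauchy_Schwarz u v : (u^T *m v) 0 0 <= enorm u * enorm v.
Proof.
have [v0|v0] := eqVneq (enorm v) 0.
  by rewrite v0 mulr0 (enorm_eq0 v0) mulmx0 mxE.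
have [u0|u0] := eqVneq (enorm u) 0.
  by rewrite u0 mul0r (enorm_eq0 u0) trmx0 mul0mx mxE.
have uv0 : 0 < enorm u * enorm v by rewrite mulr_gt0// lt_def ?u0 ?v0 enorm_ge0.
(* The square expands to [2 |u| |v| (|u| |v| - u.v)]. *)
have := sqr_ge0 (enorm (enorm v *: u + enorm u *: - v)).
rewrite sqr_enormD dotZ !enormZ ?enorm_ge0// enormN mulmxN mxE => H.
by rewrite -(ler_pM2l uv0); move: H; set p := (_ *m _) _ _; lra.
Qed.

Lemma enormD u v : enorm (u + v) <= enorm u + enorm v.
Proof.
rewrite -(ler_pXn2r (n := 2))// ?nnegrE ?addr_ge0 ?enorm_ge0//.
by rewrite sqr_enormD; have := Cauchy_Schwarz u v; lra.
Qed.

Lemma enorm_orthogonal (g : 'M[R]_n) u : g^T *m g = 1%:M -> enorm (g *m u) = enorm u.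
Proof.
move=> gg; rewrite !enormE trmx_mul mulmxA -(mulmxA u^T) gg mulmx1//.
Qed.

End EuclideanNorm.

(** * Householder reflections and transitivity of SO(n) on the unit sphere *)

Section Transitivity.
Variables (R : realType).

Definition reflection n (v : 'cV[R]_n) : 'M[R]_n := 1%:M - (2 / enorm v ^+ 2) *: (v *m v^T).

Lemma reflection_orthogonal n (v : 'cV[R]_n) : v != 0 -> (reflection v)^T *m reflection v = 1%:M.
Proof.
move=> v0; rewrite /reflection; set s := 2 / _.
have sv : s * (v^T *m v) 0 0 = 2.
  rewrite /s -sqr_enormE divfK// expf_neq0//.
  by apply: contra_neq v0 => /enorm_eq0.
have RT : (1%:M - s *: (v *m v^T))^T = 1%:M - s *: (v *m v^T).
  by rewrite [LHS]linearB/= trmx1 [X in _ - X]linearZ/= trmx_mul trmxK.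
rewrite RT mulmxBl !mulmxBr !mul1mx !mulmx1.
rewrite -[X in _ - (_ - X)]scalemxAl -scalemxAr scalerA mulmxA -(mulmxA v).
rewrite [v^T *m v]mx11_scalar mul_mx_scalar -scalemxAl scalerA -mulrA sv.
by apply/matrixP => i j; rewrite !mxE; ring.
Qed.

(** For unit vectors [|x - y|^2 = 2 - 2 x.y = - 2 (x - y).y], so the reflection adds exactly [x - y]
    to [y]. *)
Lemma reflection_swap n (x y : 'cV[R]_n) : enorm x = 1 -> enorm y = 1 -> x != y ->
  reflection (x - y) *m y = x.
Proof.
move=> x1 y1 xy; rewrite mulmxBl mul1mx -scalemxAl -mulmxA.
rewrite [(x - y)^T *m y]mx11_scalar mul_mx_scalar scalerA.
have xy0 : enorm (x - y) ^+ 2 != 0.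
  by rewrite expf_neq0//; apply: contra_neq xy => /enorm_eq0/eqP; rewrite subr_eq0 => /eqP.
suff -> : 2 / enorm (x - y) ^+ 2 * ((x - y)^T *m y) 0 0 = -1.
  by rewrite scaleN1r opprK subrKC.
apply: (mulfI xy0); rewrite mulrA mulrCA divff// mulr1.
rewrite [in RHS]sqr_enormD enormN x1 y1 mulmxN dotC mulmxBr.
have : (y^T *m y) 0 0 = 1 by rewrite -sqr_enormE y1 expr1n.
rewrite [fun_of_matrix (_ + _) _ _]mxE ![fun_of_matrix (- _) _ _]mxE (dotC y x) => ->.
ring.
Qed.

(* If the reflection taking [e1] to [x] has determinant -1, it is corrected by
   a reflection fixing [e1]. *)
Lemma SO_transitive_e1 n (x : 'cV[R]_n.+2) :
  enorm x = 1 -> exists g : SO R n.+2, (g : 'M[R]_n.+2) *m e1 R n.+1 = x.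
Proof.
move=> x1; have [->|xe] := eqVneq x (e1 R n.+1).
  by exists (so_one R n.+2); rewrite /= mul1mx.
have e11 : enorm (e1 R n.+1) = 1 by apply/eqP; exact: enorm_e1.
have xe0 : x - e1 R n.+1 != 0 by rewrite subr_eq0.
pose g := reflection (x - e1 R n.+1).
have gO : g^T *m g = 1%:M by exact: reflection_orthogonal.
have gE : g *m e1 R n.+1 = x by exact: reflection_swap.
have : \det g ^+ 2 = 1 by rewrite expr2 -{1}det_tr -det_mulmx gO det1.
move=> /eqP; rewrite sqrf_eq1 => /orP[/eqP gdet|/eqP gdet].
  have gP : (g^T *m g == 1%:M) && (\det g == 1) by rewrite gO gdet !eqxx.
  by exists (MkSO gP).
(* The sign sits in the last coordinate, which differs from the first because the dimension is at
   least 2; hence [diag_mx f] fixes [e1]. *)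
pose f : 'rV[R]_n.+2 := \row_j (if j == ord_max then -1 else 1).
have gP : ((g *m diag_mx f)^T *m (g *m diag_mx f) == 1%:M) && (\det (g *m diag_mx f) == 1).
  rewrite trmx_mul mulmxA -(mulmxA _ g^T) gO mulmx1 tr_diag_mx mulmx_diag.
  rewrite det_mulmx gdet det_diag (bigD1 ord_max)//= mxE eqxx big1 ?mulr1 ?mulrNN ?mulr1.
    rewrite eqxx andbT; apply/eqP/matrixP => i j; rewrite !mxE.
    by case: ifP => _; rewrite ?mulrNN mulr1.
  by move=> i im; rewrite mxE (negbTE im).
exists (MkSO gP); rewrite /= -mulmxA mul_diag_mx -[RHS]gE; congr (_ *m _).
by apply/matrixP => i j; rewrite !mxE; case: eqP => [->|_]; rewrite /= ?mul1r ?mulr0.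
Qed.

End Transitivity.

(** * The homogeneous space SO(n)/SO(n-1) *)

Section SOCompact.
Variables (R : realType) (n : nat).

(** Open sets of the initial topology are preimages, so a cluster point of the image filter, lying
    in the range, lifts to a cluster point. *)
Lemma compact_initial (S : choiceType) (U : topologicalType) (f : S -> U) :
  compact (range f) -> compact [set: initial_topology f].
Proof.
move=> cf F FF _; have FR : (f @ F) (range f) by apply: (@filterE _ F) => x; exists x.
have [p [[x _ <-] Fp]] := cf (f @ F) _ FR.
exists x; split => // A B FA /= [C [[V oV <-] Vx VB]].
have fA : (f @ F) (f @` A) by apply: (@filterS _ F _ A) => // a Aa; exists a.
have [|_ [[a Aa <-] Va]] := Fp (f @` A) V fA; first exact: open_nbhs_nbhs.
by exists a; split => //; exact: VB.
Qed.

(** Orthogonality and [\det M = 1] are closed conditions on the entries, and unit columns confine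
    the entries to [-1, 1]. The cube of matrices is compact as the image of a box of row vectors
    under [vec_mx]. *)
Lemma compact_SO : compact [set: SO R n].
Proof.
apply: compact_initial.
pose C := [set v : 'rV[R]_(n * n) | forall i, `[-1, 1]%classic (v ord0 i)].
have cC : compact C.
  by apply: (@rV_compact R _ (fun=> `[-1, 1]%classic)) => i; exact: segment_compact.
pose K : set 'M[R]_n := vec_mx @` C.
apply: (@subclosed_compact _ _ K).
- have -> : range (@so_mx R n) =
      [set M : 'M[R]_n | forall i j, \sum_k M k i * M k j = (i == j)%:R] `&`
      [set M | \det M = 1].
    apply/seteqP; split => [_ [g _ <-]|M [Mo Md]].
      split; last exact: so_det.
      move=> i j; have /matrixP/(_ i j) := so_trmxK g; rewrite !mxE => <-.
      by apply: eq_bigr => k _; rewrite mxE.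
    have MP : (M^T *m M == 1%:M) && (\det M == 1).
      rewrite Md eqxx andbT; apply/eqP/matrixP => i j; rewrite !mxE -Mo.
      by apply: eq_bigr => k _; rewrite mxE.
    by exists (MkSO MP).
  apply: closedI.
    rewrite (_ : mkset _ = \bigcap_i \bigcap_j
       [set M : 'M[R]_n | \sum_k M k i * M k j = (i == j)%:R]); last first.
      by apply/seteqP; split => [M H i _ j _|M H i j]; [exact: H|exact: (H i I j I)].
    apply: closed_bigI => i _; apply: closed_bigI => j _.
    apply: (@closed_comp _ _ (fun M : 'M[R]_n => \sum_k M k i * M k j)
      [set (i == j)%:R]) => [M _|]; last exact: closed_eq.
    apply: continuous_big => [|k _ N]; first exact: add_continuous.
    exact: (continuousM (@coord_continuous R n n k i N) (@coord_continuous R n n k j N)).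
  apply: (@closed_comp _ _ (fun M : 'M[R]_n => \det M) [set 1]) => [M _|]; last exact: closed_eq.
  have prodc (s : 'I_n -> 'I_n) : continuous (fun M : 'M[R]_n => \prod_i M i (s i)).
    apply: continuous_big => [|k _]; first exact: mul_continuous.
    exact: coord_continuous.
  rewrite /determinant; apply: continuous_big => [|s _ N]; first exact: add_continuous.
  exact: (@continuousM _ _ (cst ((-1) ^+ perm.odd_perm s)) _ N (@cst_continuous _ _ _ N)
    (prodc (perm.fun_of_perm s) N)).
- apply: continuous_compact cC.
  apply: continuous_subspaceT; apply: mx_continuous => i j.
  by under eq_fun do rewrite mxE; exact: coord_continuous.
- move=> _ [g _ <-]; exists (mxvec g); last by rewrite mxvecK.
  move=> k /=; case/mxvec_indexP: k => i j; rewrite mxvecE in_itv/=.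
  have : \sum_k g k j ^+ 2 = 1.
    have /matrixP/(_ j j) := so_trmxK g; rewrite !mxE eqxx => gj.
    by apply: etrans gj; apply: eq_bigr => k _; rewrite mxE expr2.
  rewrite (bigD1 i)//= => gj; have : g i j ^+ 2 <= 1.
    by rewrite -gj lerDl sumr_ge0// => k _; exact: sqr_ge0.
  by move=> gij; apply/andP; split; nra.
Qed.

End SOCompact.

(** * The chordal metric on the sphere *)

Section SphereMetric.
Variables (R : realType) (n : nat).
Local Notation S := (sphere R n.+1).

Definition sdist (x y : S) : R := enorm (sphere_vec x - sphere_vec y).

Lemma sdistxx x : sdist x x = 0.
Proof. by rewrite /sdist subrr enorm0. Qed.

Lemma sdistC x y : sdist x y = sdist y x.
Proof. by rewrite /sdist -enormN opprB. Qed.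

Lemma sdist_triangle y x z : sdist x z <= sdist x y + sdist y z.
Proof. by rewrite /sdist -(subrKA (sphere_vec y)); exact: enormD. Qed.

Lemma sdist_act (g : SO R n.+1) x y : sdist (so_act g x) (so_act g y) = sdist x y.
Proof. by rewrite /sdist/= -mulmxBr enorm_orthogonal// so_trmxK. Qed.

Lemma sphere_enorm (x : S) : enorm (x : 'cV[R]_n.+1) = 1.
Proof. exact/eqP/sphere_vecP. Qed.

Lemma enorm_continuous m : continuous (@enorm R m).
Proof.
move=> u; apply: (@continuous_comp _ _ _ (fun v : 'cV[R]_m => \sum_i v i 0 ^+ 2)
  (@Num.sqrt R)); last exact: sqrt_continuous.
apply: continuous_big => [|k _ v]; first exact: add_continuous.
apply: (@continuous_comp _ _ _ (fun v : 'cV[R]_m => v k 0) (fun t : R => t ^+ 2)).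
  exact: coord_continuous.
exact: exprn_continuous.
Qed.

Lemma sphere_vec_continuous : continuous (@sphere_vec R n.+1).
Proof. exact: initial_continuous. Qed.

Lemma sphere_coord_continuous i : continuous (fun x : S => (x : 'cV[R]_n.+1) i 0).
Proof.
move=> x; apply: (@continuous_comp _ _ _ (@sphere_vec R n.+1) (fun v : 'cV[R]_n.+1 => v i 0)).
  exact: sphere_vec_continuous.
exact: coord_continuous.
Qed.

(** The topology of matrices is that of the maximum norm. Coordinates are bounded by [enorm], which
    gives one direction; continuity of [enorm] gives the other. *)
Lemma sphere_openP (U : set S) : open U <->
  forall x, U x -> exists2 e : R, 0 < e & forall y, sdist x y < e -> U y.
Proof.
split=> [[V oV <-] x Vx|UP].
  have /nbhs_ballP[e /= e0 eV] : nbhs (x : 'cV[R]_n.+1) V by exact: open_nbhs_nbhs.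
  exists e => // y xy; apply: eV; split => // i j; rewrite ord1.
  apply: le_lt_trans xy; have := coord_le_enorm (sphere_vec x - sphere_vec y) i.
  by rewrite !mxE.
rewrite openE => x Ux; have [e e0 eU] := UP x Ux.
rewrite /interior; apply: filterS (_ : nbhs x (fun y => sdist x y < e)); first exact: eU.
have : sdist x y @[y --> x] --> sdist x x.
  apply: (@continuous_comp _ _ _ (fun y : S => sphere_vec x - sphere_vec y) (@enorm R n.+1)).
    exact: (@continuousB _ _ _ (cst (sphere_vec x)) _ x (@cst_continuous _ _ _ x)
      (@sphere_vec_continuous x)).
  exact: enorm_continuous.
by move/cvgr_lt; apply; rewrite sdistxx.
Qed.

Lemma sphere_hausdorff : hausdorff_space S.
Proof.
rewrite open_hausdorff => x y xy.
have d0 : 0 < sdist x y / 2.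
  rewrite divr_gt0// lt_def enorm_ge0 andbT; apply: contra_neq xy => /enorm_eq0/eqP.
  by rewrite subr_eq0 => /eqP/val_inj.
exists (dball sdist x (sdist x y / 2), dball sdist y (sdist x y / 2)).
  by rewrite !inE /dball/= !sdistxx.
split; [exact: (open_dball sdist_triangle sphere_openP)..|].
apply/eqP/seteqP; split => z // [] /=; rewrite /dball/= => xz.
by have := sdist_triangle z x y; rewrite (sdistC y z); lra.
Qed.

End SphereMetric.

(** * The orbit map from the quotient to the sphere *)

Section HomogeneousSphere.
Variables (R : realType) (n : nat).
Local Notation S := (sphere R n.+1).
Local Notation X := (homspace (so_stab R n)).
Local Notation e1 := (e1 R n).

(** Fixing [e1] prescribes the first column; by orthogonality the transpose fixes [e1] too, which
    prescribes the first row. *)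
Lemma so_blockP (g : SO R n.+1) : so_block g <-> (g : 'M[R]_n.+1) *m e1 = e1.
Proof.
have colE (h : 'M[R]_n.+1) i j : (h *m e1) i j = h i ord0.
  by rewrite -colE ord1 mxE.
have e1E i j : e1 i j = (i == ord0)%:R by rewrite mxE ord1 andbT.
rewrite so_blockE; split => [gP|ge i _].
  by apply/matrixP => i j; rewrite colE e1E; have [-> _] := gP i I.
have ge' : (g : 'M[R]_n.+1)^T *m e1 = e1 by rewrite -[in LHS]ge mulmxA so_trmxK mul1mx.
split; rewrite /=.
  by have /matrixP/(_ i ord0) := ge; rewrite colE e1E.
by have /matrixP/(_ i ord0) := ge'; rewrite colE e1E mxE.
Qed.

Lemma natural_rep_fixed : fixed_by (so_stab R n) (so_natural_rep R n.+1) e1.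
Proof. by move=> h /so_blockP. Qed.

Lemma gcoset_eq (g h : SO R n.+1) :
  gcoset (so_stab R n) g = gcoset (so_stab R n) h <->
  (g : 'M[R]_n.+1) *m e1 = (h : 'M[R]_n.+1) *m e1.
Proof.
rewrite /gcoset; split => [/eqmodP/asboolP/so_blockP|gh].
  move=> /(congr1 (fun v => (g : 'M[R]_n.+1) *m v)).
  by rewrite !mulmxA so_mulmxV mul1mx.
apply/eqmodP/asboolP/so_blockP.
by rewrite /= -mulmxA -gh mulmxA so_trmxK mul1mx.
Qed.

Lemma gcosetK (x : X) : gcoset (so_stab R n) (repr x) = x.
Proof. exact: reprK. Qed.

Lemma coset_to_sphereE (g : SO R n.+1) :
  (coset_to_sphere (gcoset (so_stab R n) g) : 'cV[R]_n.+1) = (g : 'M[R]_n.+1) *m e1.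
Proof. by rewrite /=; apply/gcoset_eq; rewrite gcosetK. Qed.

Lemma coset_to_sphere_act g (x : X) :
  coset_to_sphere (coset_act g x) = so_act g (coset_to_sphere x).
Proof.
by apply: val_inj; rewrite /coset_act [LHS]coset_to_sphereE/= mulmxA.
Qed.

Lemma coset_to_sphere_inj : injective (@coset_to_sphere R n).
Proof.
move=> x y /(congr1 val) /= xy; rewrite -(gcosetK x) -(gcosetK y).
exact/gcoset_eq.
Qed.

Lemma coset_to_sphere_continuous : continuous (@coset_to_sphere R n).
Proof.
apply/quotient_continuous; apply: continuous_comp_initial; apply: mx_continuous => i j.
rewrite (_ : (fun _ => _) = (fun g : SO R n.+1 => g i ord0)); last first.
  apply/funext => g; rewrite /=.
  have /matrixP/(_ i j) := coset_to_sphereE g; rewrite /= => ->.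
  by rewrite -colE mxE.
exact: so_coord_continuous.
Qed.

Lemma compact_homspace : compact [set: X].
Proof.
rewrite (_ : [set: X] = gcoset (so_stab R n) @` [set: SO R n.+1]).
  apply: continuous_compact (@compact_SO R n.+1).
  by apply: continuous_subspaceT; exact: pi_continuous.
by apply/seteqP; split => // x _; exists (repr x) => //; exact: gcosetK.
Qed.

End HomogeneousSphere.

Section HomogeneousSphereHomeo.
Variables (R : realType) (n : nat).
Local Notation S := (sphere R n.+2).
Local Notation X := (homspace (so_stab R n.+1)).

Lemma so_act_transitive (x y : S) : exists g : SO R n.+2, so_act g x = y.
Proof.
have [g gx] := SO_transitive_e1 (sphere_enorm x).
have [h hy] := SO_transitive_e1 (sphere_enorm y).
exists (h * g^-1)%g; apply: val_inj.
by rewrite /= -gx -hy -mulmxA (mulmxA _^T) so_trmxK mul1mx.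
Qed.

(** The inverse is continuous because the preimage of a closed set under it is the image of a
    compact set, hence compact and closed in the Hausdorff sphere. *)
Lemma sphere_to_coset_exists : exists s : S -> X,
  [/\ cancel (@coset_to_sphere R n.+1) s, cancel s (@coset_to_sphere R n.+1)
    & continuous s].
Proof.
have /choice[s sK] : forall x : S, exists y : X, coset_to_sphere y = x.
  move=> x; have [g gx] := SO_transitive_e1 (sphere_enorm x).
  by exists (gcoset (so_stab R n.+1) g); apply: val_inj; rewrite [LHS]coset_to_sphereE.
have Ks : cancel (@coset_to_sphere R n.+1) s.
  by move=> y; apply: coset_to_sphere_inj; rewrite sK.
exists s; split => //; apply/continuous_closedP => A cA.
rewrite (_ : s @^-1` A = @coset_to_sphere R n.+1 @` A).
  apply: compact_closed; first exact: sphere_hausdorff.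
  apply: continuous_compact.
    by apply: continuous_subspaceT; exact: coset_to_sphere_continuous.
  exact: subclosed_compact (@compact_homspace R n.+1) _.
apply/seteqP; split => [x As|x [y Ay <-]]; first by exists (s x).
by rewrite /= Ks.
Qed.

Lemma compact_sphere : compact [set: S].
Proof.
have [s [_ sK _]] := sphere_to_coset_exists.
rewrite (_ : [set: S] = @coset_to_sphere R n.+1 @` [set: X]).
  apply: continuous_compact (@compact_homspace R n.+1).
  by apply: continuous_subspaceT; exact: coset_to_sphere_continuous.
by apply/seteqP; split => // x _; exists (s x).
Qed.

(* [tau] is bounded on the compact group, whereas [tau (g ^+ k)] grows linearly in [k]. *)
Lemma SO_hom_trivial (tau : SO R n.+2 -> R) : continuous tau ->
  (forall g h, tau (g * h)%g = tau g + tau h) -> forall g, tau g = 0.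
Proof.
move=> tc tM.
have : compact (tau @` [set: SO R n.+2]).
  by apply: continuous_compact (@compact_SO R n.+2); exact: continuous_subspaceT.
move=> /compact_bounded[M [_ /(_ (M + 1))]]; rewrite ltrDl ltr01 => /(_ isT) tM1.
have tX g k : tau (g ^+ k)%g = tau g *+ k.
  elim: k => [|k IH]; last by rewrite expgS tM IH mulrS.
  by rewrite expg0 mulr0n; have := tM 1%g 1%g; rewrite mulg1; lra.
move=> g; apply/eqP; rewrite -normr_le0; apply/ler_addgt0Pr => e e0; rewrite add0r.
have [k kM] : exists k : nat, (M + 1) / e < k%:R.
  by exists (Num.bound `|(M + 1) / e|); rewrite (le_lt_trans (ler_norm _))// archi_boundP.
have /= := tM1 (tau (g ^+ k)%g) (ex_intro2 _ _ _ I erefl).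
rewrite tX normrMn -mulr_natl => gM.
rewrite leNgt; apply/negP => eg; move: kM; rewrite ltr_pdivrMr// => kM.
have k0 : 0 <= k%:R :> R by [].
by move: gM; rewrite leNgt => /negP; apply; apply: lt_le_trans kM _; rewrite ler_wpM2l// ltW.
Qed.

End HomogeneousSphereHomeo.

(** * The Gamma function *)

Section GammaFunction.
Variable R : realType.
Local Notation lebesgue := (@lebesgue_measure R).

(** Half of the exponential absorbs the power: for [t <= 1] the constant 1 is enough, beyond that
    the term of degree [N.+1] in the series of [expR (t / 2)]. *)
Lemma powR_expR_bound (a : R) : 0 <= a ->
  exists2 C : R, 0 <= C & forall t, 0 <= t -> t `^ a * expR (- t) <= C * expR (- (t / 2)).
Proof.
move=> a0; have [N aN] : exists N : nat, a <= N.+1%:R.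
  by exists (Num.bound a); apply/ltW/(lt_trans (archi_boundP a0)); rewrite ltr_nat.
exists (1 + 2 ^+ N.+1 * N.+1`!%:R) => [|t t0].
  by rewrite addr_ge0// mulr_ge0// exprn_ge0.
have -> : expR (- t) = expR (- (t / 2)) * expR (- (t / 2)).
  by rewrite -expRD; congr expR; lra.
rewrite mulrA ler_pM2r ?expR_gt0// expRN ler_pdivrMr ?expR_gt0//.
have e1 : 1 <= expR (t / 2) by rewrite -expR0 ler_expR divr_ge0.
have [t1|t1] := leP t 1.
  apply: (@le_trans _ _ 1).
    have [->|tn0] := eqVneq t 0.
      by have [->|an0] := eqVneq a 0; rewrite ?powRr0 ?powR0.
    rewrite -(powRr0 t) ger_powR// t1 andbT lt_def tn0//.
  apply: mulr_ege1 => //; rewrite lerDl mulr_ge0// exprn_ge0//.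
apply: (@le_trans _ _ (t ^+ N.+1)).
  by rewrite -powR_mulrn// ler_powR// ltW.
have := expR_ge1Dxn N (_ : 0 <= t / 2).
move=> /(_ (divr_ge0 t0 (ler0n _ _))) => H.
have {}H : (t / 2) ^+ N.+1 / N.+1`!%:R <= expR (t / 2) by lra.
move: H; rewrite ler_pdivrMr ?ltr0n ?fact_gt0// expr_div_n ler_pdivrMr ?exprn_gt0// => H.
apply: le_trans H _; rewrite -mulrA mulrC ler_wpM2r ?expR_ge0//.
by rewrite mulrC lerDr.
Qed.

Let half_exp_continuous : continuous (fun t : R => expR (- (t / 2))).
Proof.
move=> t; apply: (@continuous_comp _ _ _ (fun t : R => - (t / 2)) expR);
  last exact: continuous_expR.
by apply: cvgN; apply: cvgMr_tmp; exact: cvg_id.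
Qed.

Lemma cvgy_half_exp : expR (- (t / 2)) @[t --> +oo] --> (0 : R).
Proof.
apply: (@cvg_comp _ _ _ (fun t : R => t / 2) (fun t : R => expR (- t)) _ (pinfty_nbhs R)).
  apply/cvgryPge => A; apply: filterS (nbhs_pinfty_ge (num_real (A * 2))) => t.
  by rewrite ler_pdivlMr.
exact: cvgr_expR.
Qed.

Let derive_half_exp (t : R) :
  is_derive t 1 (fun t : R => - 2 * expR (- (t / 2))) (expR (- (t / 2))).
Proof.
have H : is_derive t 1 (fun t : R => - (t / 2)) (- 2^-1).
  have -> : (fun t : R => - (t / 2)) = ( *%R (- 2^-1)) by apply/funext => x; lra.
  by apply: is_derive_eq; rewrite scaler1.
by apply: is_derive_eq; rewrite /GRing.scale/=; lra.
Qed.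

Let powR_right_continuous (a : R) : 0 <= a -> t `^ a @[t --> 0^'+] --> (0 `^ a : R).
Proof.
move=> a0; have [->|an0] := eqVneq a 0.
  under eq_fun do rewrite powRr0; rewrite powRr0; exact: cvg_cst.
by rewrite powR0//; apply: powR_cvg0; rewrite lt_def an0.
Qed.

Let powR_continuous (a : R) (t : R) : 0 < t -> {for t, continuous (fun u : R => u `^ a)}.
Proof.
move=> t0; apply: differentiable_continuous; apply/derivable1_diffP.
by apply: derivable_powR; rewrite in_itv/= t0.
Qed.

(** The Gamma integrand with [a = s - 1]. For [0 <= a] it is continuous up to 0; the arguments
    [k + n/2] with n at least 2 all fall in this range. *)
Definition gamma_kernel (a t : R) : R := t `^ a * expR (- t).

Let kernel_continuous (a : R) (t : R) : 0 < t -> {for t, continuous (gamma_kernel a)}.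
Proof.
move=> t0; apply: continuousM; first exact: powR_continuous.
apply: (@continuous_comp _ _ _ (fun t : R => - t) expR); last exact: continuous_expR.
exact: opp_continuous.
Qed.

Let kernel_right_continuous (a : R) : 0 <= a ->
  gamma_kernel a t @[t --> 0^'+] --> gamma_kernel a 0.
Proof.
move=> a0; apply: cvgM; first exact: powR_right_continuous.
apply: cvg_at_right_filter.
apply: (@continuous_comp _ _ _ (fun t : R => - t) expR); last exact: continuous_expR.
exact: opp_continuous.
Qed.

Let kernel_within_continuous (a : R) : 0 <= a ->
  {within `[0, +oo[, continuous (gamma_kernel a)}.
Proof.
move=> a0; apply/continuous_within_itvcyP; split; last exact: kernel_right_continuous.
by move=> t; rewrite in_itv/= andbT; exact: kernel_continuous.
Qed.

Let derive_kernel (a t : R) : 0 < t ->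
  is_derive t 1 (gamma_kernel a) (a * gamma_kernel (a - 1) t - gamma_kernel a t).
Proof.
move=> t0; rewrite /gamma_kernel.
have H : is_derive t 1 (fun u : R => expR (- u)) (- expR (- t)).
  by apply: is_derive_eq; rewrite mulrN1.
have P := is_derive1_powR a t0.
by apply: is_derive_eq; rewrite /GRing.scale/=; ring.
Qed.

Let kernel_ge0 (a t : R) : 0 <= gamma_kernel a t.
Proof. by rewrite mulr_ge0 ?powR_ge0 ?expR_ge0. Qed.

Let measurable_kernel (a : R) : 0 <= a ->
  measurable_fun (`[0, +oo[%classic : set R) (gamma_kernel a).
Proof.
move=> a0; apply: subspace_continuous_measurable_fun => //.
exact: kernel_within_continuous.
Qed.

Lemma integral_half_exp :
  (\int[lebesgue]_(t in `[0%R, +oo[) (expR (- (t / 2)))%:E = 2%:E)%E.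
Proof.
rewrite (@ge0_continuous_FTC2y _ _ (fun t : R => - 2 * expR (- (t / 2))) 0 0).
- by rewrite mul0r oppr0 expR0 mulr1 -EFinB sub0r opprK.
- by move=> x _; exact: expR_ge0.
- exact: continuous_subspaceT.
- by rewrite -[X in _ --> X](mulr0 (-2)); apply: cvgMl_tmp; exact: cvgy_half_exp.
- by move=> x _; have [] := derive_half_exp x.
- apply: cvg_at_right_filter.
  have := derive_half_exp 0; case=> /derivable1_diffP /differentiable_continuous + _; exact.
- by move=> x _; rewrite derive1E; have [] := derive_half_exp x.
Qed.

Lemma integrable_half_exp (C : R) :
  lebesgue.-integrable `[0, +oo[ (EFin \o (fun t => C * expR (- (t / 2)))).
Proof.
have -> : EFin \o (fun t => C * expR (- (t / 2))) =
    (fun t => C%:E * (expR (- (t / 2)))%:E)%E by [].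
apply: integrableZl => //.
apply/integrableP; split.
  by apply/measurable_EFinP; apply: measurable_funTS; exact: continuous_measurable_fun.
under eq_integral do rewrite /= ger0_norm ?expR_ge0//.
by rewrite integral_half_exp ltry.
Qed.

Lemma integrable_gamma_kernel (a : R) : 0 <= a ->
  lebesgue.-integrable `[0, +oo[ (EFin \o gamma_kernel a).
Proof.
move=> a0; have [C C0 aC] := powR_expR_bound a0.
apply: le_integrable (integrable_half_exp C) => //.
  by apply/measurable_EFinP; exact: measurable_kernel.
move=> t; rewrite /= in_itv/= andbT => t0; rewrite lee_fin ger0_norm//.
by apply: le_trans (ler_norm _); exact: aC.
Qed.

Lemma GammaE (s : R) : 1 <= s ->
  Gamma s = \int[lebesgue]_(t in `[0, +oo[) gamma_kernel (s - 1) t.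
Proof.
move=> s1; rewrite /Gamma Rintegral_itv_obnd_cbnd//.
have a0 : 0 <= s - 1 by rewrite subr_ge0.
apply: (integrableS _ _ _ (integrable_gamma_kernel a0)) => // t.
by rewrite /= !in_itv/= !andbT; exact: ltW.
Qed.

Lemma Gamma_gt0 (s : R) : 1 <= s -> 0 < Gamma s.
Proof.
move=> s1; have a0 : 0 <= s - 1 by rewrite subr_ge0.
rewrite GammaE//.
(* On [1, 2] the power is at least 1 and the exponential at least [expR (- 2)]. *)
apply: (@lt_le_trans _ _ (\int[lebesgue]_(t in `[1, 2]) expR (- 2))).
  rewrite Rintegral_cst//= lebesgue_measure_itv/= lte_fin ltr1n/=.
  by rewrite mulr_gt0 ?expR_gt0//; lra.
have sub : `[1, 2]%classic `<=` (`[0, +oo[%classic : set R).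
  by move=> t; rewrite /= !in_itv/= andbT => /andP[t1 _]; apply: le_trans t1.
rewrite /Rintegral fine_le//.
- by rewrite integral_cst//= lebesgue_measure_itv/= lte_fin ltr1n.
- by apply: integrable_fin_num => //; exact: integrable_gamma_kernel.
apply: (@le_trans _ _ (\int[lebesgue]_(t in `[1%R, 2%R]) (gamma_kernel (s - 1) t)%:E)%E).
  apply: ge0_le_integral => //.
  - apply/measurable_EFinP.
    by refine (@measurable_funS _ _ _ _ _ _ _ _ sub (measurable_kernel a0)) => //.
  - move=> t; rewrite /= in_itv/= lee_fin => /andP[t1 t2].
    rewrite /gamma_kernel -[leLHS]mul1r; apply: ler_pM; rewrite ?expR_ge0//.
      by rewrite -[leLHS](powRr0 t) ler_powR.
    by rewrite ler_expR lerN2.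
apply: ge0_subset_integral => //.
- by apply/measurable_EFinP; exact: measurable_kernel.
- by move=> t _; rewrite lee_fin kernel_ge0.
Qed.

(* The boundary terms of the integration by parts are absorbed by a multiple of
   [exp (- t / 2)], which makes the integrand nonnegative. *)
Lemma GammaS (s : R) : 1 <= s -> Gamma (s + 1) = s * Gamma s.
Proof.
move=> s1; have a0 : 0 <= s - 1 by rewrite subr_ge0.
have s0 : 0 < s by apply: lt_le_trans s1.
have [C C0 aC] := powR_expR_bound a0.
have [D D0 sD] := powR_expR_bound (ltW s0).
rewrite !GammaE//; last by rewrite lerDr ltW.
rewrite addrK.
(* [F] is an antiderivative of [f] with [F 0 = - 2 s C] and limit 0 at infinity, so [f] has integral
   [2 s C]. The added exponential term alone has the same integral; the other two terms therefore
   cancel. *)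
pose F t := - gamma_kernel s t + s * C * (- 2 * expR (- (t / 2))).
pose f t := gamma_kernel s t + - (s * gamma_kernel (s - 1) t) + s * C * expR (- (t / 2)).
have f_int : (\int[lebesgue]_(t in `[0%R, +oo[) (f t)%:E = (2 * s * C)%:E)%E.
  rewrite (@ge0_continuous_FTC2y _ _ F 0 0).
  - rewrite /F /gamma_kernel powR0 ?gt_eqF// !mul0r !oppr0 expR0 -EFinB; congr EFin; lra.
  - move=> t t0; rewrite /f addrAC subr_ge0.
    apply: le_trans (_ : _ <= s * (C * expR (- (t / 2)))) _.
      by rewrite ler_pM2l//; exact: aC.
    by rewrite mulrA lerDr kernel_ge0.
  - apply/continuous_within_itvcyP; split.
      move=> t; rewrite in_itv/= andbT => t0.
      apply: cvgD; last by apply: cvgMl_tmp; exact: half_exp_continuous.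
      apply: cvgB; first exact: kernel_continuous.
      by apply: cvgMl_tmp; exact: kernel_continuous.
    apply: cvgD; last first.
      by apply: cvg_at_right_filter; apply: cvgMl_tmp; exact: half_exp_continuous.
    apply: cvgB; first exact: kernel_right_continuous (ltW s0).
    by apply: cvgMl_tmp; exact: kernel_right_continuous.
  - have -> : 0 = - 0 + s * C * (- 2 * 0) :> R by lra.
    apply: cvgD; last by do 2 apply: cvgMl_tmp; exact: cvgy_half_exp.
    apply: cvgN; apply: (@squeeze_cvgr _ _ _ _ (cst 0) (fun t => D * expR (- (t / 2)))).
    + near=> t; rewrite kernel_ge0/= sD//.
    + exact: cvg_cst.
    + by rewrite -[X in _ --> X](mulr0 D); apply: cvgMl_tmp; exact: cvgy_half_exp.
  - move=> t t0; apply: derivableD.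
      by apply: derivableN; have [] := derive_kernel s t0.
    by apply: derivableZ; have [] := derive_half_exp t.
  - apply: cvgD; first by apply: cvgN; apply: kernel_right_continuous; exact: ltW.
    apply: cvg_at_right_filter; do 2 apply: cvgMl_tmp; exact: half_exp_continuous.
  - move=> t; rewrite in_itv/= andbT => t0; rewrite derive1E.
    have H1 := derive_kernel s t0; have H2 := derive_half_exp t.
    have := @derive_val _ _ _ _ _ _ _ (is_deriveD (is_deriveN H1) (is_deriveZ (s * C) H2)).
    by move=> /= ->; rewrite /f /GRing.scale/=; ring.
have is_ := integrable_gamma_kernel (ltW s0).
have is1 : lebesgue.-integrable `[0, +oo[ (EFin \o (fun t => s * gamma_kernel (s - 1) t)).
  exact: (integrableZl _ s (integrable_gamma_kernel a0)).
have ie := integrable_half_exp (s * C).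
have : \int[lebesgue]_(t in `[0, +oo[) f t = 2 * s * C by rewrite /Rintegral f_int.
rewrite RintegralD//; last exact: (integrableB _ is_ is1).
rewrite RintegralB// RintegralZl//; last exact: integrable_gamma_kernel.
have -> : \int[lebesgue]_(t in `[0, +oo[) (s * C * expR (- (t / 2))) = 2 * s * C.
  rewrite RintegralZl//; last first.
    have <- : (fun t : R => 1 * expR (- (t / 2))) = (fun t => expR (- (t / 2))).
      by apply: boolp.funext => t; rewrite mul1r.
    exact: integrable_half_exp.
  by rewrite /Rintegral integral_half_exp /=; ring.
lra.
Unshelve. all: by end_near. Qed.

End GammaFunction.

(** * Moments of the invariant measure *)

Section BorelMeasurability.
Variables (R : realType) (T : ptopologicalType).

Lemma borel_continuous_measurable (U : ptopologicalType) (f : T -> U) :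
  continuous f -> measurable_fun [set: borel T] (f : borel T -> borel U).
Proof.
move=> fc; apply: (@measurability _ _ (borel T) (borel U) _ _ (@open U)) => // _ [V oV <-].
by rewrite setTI; apply: open_borel; move/continuousP : fc; exact.
Qed.

Lemma borel_continuous_measurableR (f : T -> R) :
  continuous f -> measurable_fun [set: borel T] (f : borel T -> R).
Proof.
move=> fc; apply: (measurability _ (RGenOInfty.measurableE R)) => _ [_ [r ->] <-].
by rewrite setTI; apply: open_borel; move/continuousP : fc; apply; exact: interval_open.
Qed.

Lemma compact_continuous_bounded (f : T -> R) : compact [set: T] -> continuous f ->
  exists M, forall x, `|f x| <= M.
Proof.
move=> cT fc; have : compact (f @` [set: T]).
  by apply: continuous_compact => //; exact: continuous_subspaceT.
move=> /compact_bounded[M [_ /(_ (M + 1))]]; rewrite ltrDl ltr01 => /(_ isT) fM.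
by exists (M + 1) => x; apply: fM; exists x.
Qed.

Lemma compact_continuous_integrable (m : {finite_measure set (borel T) -> \bar R})
    (f : T -> R) : compact [set: T] -> continuous f ->
  m.-integrable [set: borel T] (EFin \o f).
Proof.
move=> cT fc; have [M fM] := compact_continuous_bounded cT fc.
apply: le_integrable (finite_measure_integrable_cst m M measurableT) => //.
  by apply/measurable_EFinP; exact: borel_continuous_measurableR.
by move=> x _; rewrite /= lee_fin (le_trans (fM x))// ler_norm.
Qed.

End BorelMeasurability.

Section Moments.
Variables (R : realType) (n : nat).
Local Notation S := (sphere R n.+2).
Local Notation e1 := (e1 R n.+1).
Variable m : {finite_measure set (borel S) -> \bar R}.
Hypothesis m_inv : forall (g : SO R n.+2) (A : set (borel S)), measurable A ->
  m (so_act g @^-1` A) = m A.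

Definition dot (mu : 'cV[R]_n.+2) (x : S) : R := (mu^T *m sphere_vec x) 0 0.

Lemma dot_sum mu x : dot mu x = \sum_i mu i 0 * sphere_vec x i 0.
Proof. exact: dotE. Qed.

Lemma dot_continuous mu : continuous (dot mu).
Proof.
rewrite (_ : dot mu = fun x => \sum_i mu i 0 * sphere_vec x i 0); last first.
  by apply/funext => x; exact: dot_sum.
apply: continuous_big => [|i _ x]; first exact: add_continuous.
apply: (@continuous_comp _ _ _ (fun x : S => sphere_vec x i 0) ( *%R (mu i 0))).
  exact: sphere_coord_continuous.
exact: mulrl_continuous.
Qed.

Lemma dot_le mu x : `|dot mu x| <= enorm mu.
Proof.
have := Cauchy_Schwarz mu (sphere_vec x); rewrite sphere_enorm mulr1 => mux.
have := Cauchy_Schwarz (- mu) (sphere_vec x); rewrite sphere_enorm mulr1 enormN.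
by rewrite linearN/= mulNmx mxE ler_norml mux andbT -/(dot mu x) => ?; lra.
Qed.

Lemma so_act_continuous (g : SO R n.+2) : continuous (so_act g : S -> S).
Proof.
apply/continuousP => U /sphere_openP oU; apply/sphere_openP => x Ux.
by have [e e0 eU] := oU _ Ux; exists e => // y xy; apply: eU; rewrite sdist_act.
Qed.

Lemma continuous_sphere_integrable (f : S -> R) : continuous f ->
  m.-integrable [set: borel S] (EFin \o f).
Proof. by apply: compact_continuous_integrable; exact: compact_sphere. Qed.

Lemma Rintegral_rotation (g : SO R n.+2) (f : S -> R) : continuous f ->
  \int[m]_x f (so_act g x) = \int[m]_x f x.
Proof.
move=> fc; rewrite /Rintegral; congr fine.
have mg : measurable_fun [set: borel S] (so_act g : borel S -> borel S).
  by apply: borel_continuous_measurable; exact: so_act_continuous.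
transitivity (\int[pushforward m (so_act g : borel S -> borel S)]_x (f x)%:E)%E.
  rewrite (integral_pushforward mg)//.
    by apply/measurable_EFinP; exact: borel_continuous_measurableR.
  apply: (@continuous_sphere_integrable (f \o so_act g)).
  by move=> x; apply: continuous_comp; [exact: so_act_continuous|exact: fc].
by apply: eq_measure_integral => A mA _; exact: m_inv.
Qed.

Definition moment (k : nat) (mu : 'cV[R]_n.+2) : R := \int[m]_x dot mu x ^+ k.

Lemma dotX_continuous k mu : continuous (fun x => dot mu x ^+ k).
Proof.
move=> x; apply: (@continuous_comp _ _ _ (dot mu) (fun t : R => t ^+ k)).
  exact: dot_continuous.
exact: exprn_continuous.
Qed.

Lemma dot_act (g : SO R n.+2) mu x : dot mu (so_act (g^-1)%g x) = dot ((g : 'M[R]_n.+2) *m mu) x.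
Proof. by rewrite /dot/= trmx_mul mulmxA. Qed.

Lemma momentE k mu : moment k mu = enorm mu ^+ k * moment k e1.
Proof.
have [mu0|mu0] := eqVneq (enorm mu) 0.
  (* The zero vector has no direction to rotate to; at [k = 0] the convention [0 ^+ 0 = 1] keeps the
     formula true. *)
  rewrite (enorm_eq0 mu0) enorm0; case: k => [|k].
    by rewrite expr0 mul1r /moment; apply: eq_Rintegral => x _; rewrite !expr0.
  rewrite expr0n mul0r; transitivity (\int[m]_(x in [set: borel S]) (0 : R)).
    by apply: eq_Rintegral => x _; rewrite /dot trmx0 mul0mx mxE expr0n.
  by rewrite Rintegral_cst// mul0r.
pose u := (enorm mu)^-1 *: mu.
have u1 : enorm u = 1 by rewrite enormZ ?invr_ge0 ?enorm_ge0// mulVf.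
have [g gu] := SO_transitive_e1 u1.
have muE : mu = enorm mu *: ((g : 'M[R]_n.+2) *m e1) by rewrite gu scalerA divff// scale1r.
transitivity (\int[m]_x (enorm mu ^+ k * dot e1 (so_act (g^-1)%g x) ^+ k)).
  apply: eq_Rintegral => x _; rewrite dot_act -exprMn; congr (_ ^+ k).
  by rewrite [in LHS]muE /dot linearZ/= -scalemxAl mxE.
rewrite RintegralZl//; last first.
  apply: (@continuous_sphere_integrable (fun x => dot e1 (so_act (g^-1)%g x) ^+ k)).
  under eq_fun do rewrite dot_act; exact: dotX_continuous.
by rewrite (@Rintegral_rotation (g^-1)%g (fun x => dot e1 x ^+ k))//; exact: dotX_continuous.
Qed.

(** The map [x -> - x] is not a rotation in odd dimension, but [- e1] has the norm of [e1], hence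
    the same moment, while an odd power changes sign. *)
Lemma moment_odd k : odd k -> moment k e1 = 0.
Proof.
move=> ok; have := momentE k (- e1); rewrite enormN.
have /eqP -> := enorm_e1 R n.+1; rewrite expr1n mul1r => H.
have : moment k (- e1) = - moment k e1.
  rewrite /moment -mulN1r -RintegralZl//; last first.
    exact: (continuous_sphere_integrable (@dotX_continuous k e1)).
  apply: eq_Rintegral => x _.
  by rewrite /dot linearN/= mulNmx mxE exprNn -signr_odd ok expr1.
lra.
Qed.

End Moments.

(** A nonzero difference would vanish at 0, 1, 2, ..., as many points as its size. *)
Lemma poly_horner_inj (R : realType) (p q : {poly R}) :
  (forall x, p.[x] = q.[x]) -> p = q.
Proof.
move=> pq; apply/eqP; rewrite -subr_eq0; apply/negPn/negP => r0.
have := @max_poly_roots _ (p - q) [seq i%:R | i <- iota 0 (size (p - q))] r0.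
rewrite size_map size_iota ltnn => H; suff : false by []; apply: H.
  by apply/allP => x _; rewrite rootE !hornerE pq subrr.
rewrite map_inj_uniq ?iota_uniq// => i j /eqP; rewrite eqr_nat => /eqP //.
Qed.

Lemma coef2_expr1DX2 (R : realType) k : ((1 + 'X^2 : {poly R}) ^+ k)`_2 = k%:R.
Proof.
have c0 j : ((1 + 'X^2 : {poly R}) ^+ j)`_0 = 1.
  by rewrite -horner_coef0 !hornerE expr0n addr0 expr1n.
elim: k => [|k IH]; first by rewrite expr0 coef1.
by rewrite exprSr mulrDr mulr1 coefD coefMXn/= IH c0 -natr1.
Qed.

(** * The recursion for the even moments *)

Section MomentRecursion.
Variables (R : realType) (n : nat).
Local Notation S := (sphere R n.+2).
Local Notation e1 := (e1 R n.+1).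
Variable m : {finite_measure set (borel S) -> \bar R}.
Hypothesis m_inv : forall (g : SO R n.+2) (A : set (borel S)), measurable A ->
  m (so_act g @^-1` A) = m A.

Lemma Rintegral_sum_sphere (I : Type) (s : seq I) (P : pred I) (F : I -> S -> R) :
  (forall i, continuous (F i)) ->
  \int[m]_x (\sum_(i <- s | P i) F i x) = \sum_(i <- s | P i) \int[m]_x F i x.
Proof.
move=> Fc; elim: s => [|i s IH].
  rewrite big_nil; transitivity (\int[m]_(x in [set: borel S]) (0 : R)).
    by apply: eq_Rintegral => x _; rewrite big_nil.
  by rewrite Rintegral_cst// mul0r.
rewrite big_cons -IH; case: ifP => Pi; last first.
  by apply: eq_Rintegral => x _; rewrite big_cons Pi.
rewrite -RintegralD//.
- by apply: eq_Rintegral => x _; rewrite big_cons Pi.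
- exact: continuous_sphere_integrable.
- apply: (@continuous_sphere_integrable _ _ _ (fun x => \sum_(j <- s | P j) F j x)).
  by apply: continuous_big => [|j _]; [exact: add_continuous|exact: Fc].
Qed.

Lemma sphere_coordX_continuous (i j : 'I_n.+2) p q :
  continuous (fun x : S => sphere_vec x i 0 ^+ p * sphere_vec x j 0 ^+ q).
Proof.
have coordX k r : continuous (fun x : S => sphere_vec x k 0 ^+ r).
  move=> x; apply: (@continuous_comp _ _ _ (fun x : S => sphere_vec x k 0) (fun t : R => t ^+ r)).
    exact: sphere_coord_continuous.
  exact: exprn_continuous.
by move=> x; exact: (continuousM (coordX i p x) (coordX j q x)).
Qed.

Lemma dot_e1 (x : S) : dot e1 x = sphere_vec x ord0 0.
Proof.
rewrite dot_sum (bigD1 ord0)//= big1 ?addr0; last first.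
  by move=> i i0; rewrite mxE (negbTE i0) mul0r.
by rewrite mxE !eqxx mul1r.
Qed.

(* Compare the coefficients of [t ^ 2] in the moment of [e1 + t e_j]. *)
Lemma mixed_moment (j : 'I_n.+2) k : j != ord0 ->
  'C(k.+1.*2, 2)%:R * \int[m]_x (sphere_vec x ord0 0 ^+ k.*2 * sphere_vec x j 0 ^+ 2) =
  k.+1%:R * moment m k.+1.*2 e1.
Proof.
move=> j0; set p := k.+1.*2.
pose b i := \int[m]_x (sphere_vec x ord0 0 ^+ (p - i) * sphere_vec x j 0 ^+ i).
have momE t : \sum_(i < p.+1) ('C(p, i)%:R * b i) * t ^+ i =
    (1 + t ^+ 2) ^+ k.+1 * moment m p e1.
  pose u := e1 + t *: delta_mx j 0.
  have uE : enorm u ^+ 2 = 1 + t ^+ 2.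
    rewrite sqr_enormD; have /eqP -> := enorm_e1 R n.+1.
    have -> : enorm (t *: delta_mx j 0 : 'cV[R]_n.+2) ^+ 2 = t ^+ 2.
      rewrite sqr_enorm (bigD1 j)//= big1 ?addr0; last first.
        by move=> i ij; rewrite !mxE (negbTE ij) mulr0 expr0n.
      by rewrite !mxE !eqxx mulr1.
    rewrite -scalemxAr trmx_delta mul_delta_mx_cond eq_sym (negbTE j0) mulr0n.
    by rewrite !mxE !mulr0 expr1n addr0.
  transitivity (moment m p u); last first.
    by rewrite momentE// /p -muln2 mulnC exprM uE.
  rewrite /moment; transitivity (\int[m]_x (\sum_(i < p.+1)
      ('C(p, i)%:R * t ^+ i) * (sphere_vec x ord0 0 ^+ (p - i) * sphere_vec x j 0 ^+ i))).
    rewrite Rintegral_sum_sphere => [|i].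
      apply: eq_bigr => i _; rewrite mulrAC RintegralZl//.
      apply: continuous_sphere_integrable; exact: sphere_coordX_continuous.
    move=> x; exact: (continuousM (@cst_continuous _ _ _ x) (@sphere_coordX_continuous _ _ _ _ x)).
  apply: eq_Rintegral => x _.
  have -> : dot u x = sphere_vec x ord0 0 + t * sphere_vec x j 0.
    rewrite -dot_e1 /dot /u linearD/= mulmxDl mxE; congr (_ + _).
    rewrite dotE (bigD1 j)//= big1 ?addr0; last first.
      by move=> i ij; rewrite !mxE (negbTE ij) mulr0 mul0r.
    by rewrite !mxE !eqxx mulr1.
  rewrite exprDn; apply: eq_bigr => i _; rewrite exprMn -mulr_natl; ring.
have : \poly_(i < p.+1) ('C(p, i)%:R * b i) = moment m p e1 *: (1 + 'X^2) ^+ k.+1.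
  apply: poly_horner_inj => t; rewrite horner_poly momE !hornerE mulrC//.
move=> /(congr1 (fun q : {poly R} => q`_2)).
rewrite coef_poly coefZ coef2_expr1DX2 /p doubleS !ltnS leq0n/= => H.
rewrite [RHS]mulrC -{}H; congr (_ * _); apply: eq_Rintegral => x _.
by rewrite /b /p doubleS subn2.
Qed.

(** On the sphere the squares of the other [n.+1] coordinates sum to one minus that of the first, so
    the mixed moments sum to the difference of two even moments. The binomial in each of them is
    [(k+1)(2k+1)], and [k+1] cancels. *)
Lemma moment_rec k :
  (k.*2.+1)%:R * moment m k.*2 e1 = (k.*2 + n.+2)%:R * moment m k.+1.*2 e1.
Proof.
have sumE : \sum_(j < n.+2 | j != ord0)
    \int[m]_x (sphere_vec x ord0 0 ^+ k.*2 * sphere_vec x j 0 ^+ 2) =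
    moment m k.*2 e1 - moment m k.+1.*2 e1.
  rewrite -Rintegral_sum_sphere; last by move=> j; exact: sphere_coordX_continuous.
  rewrite /moment -RintegralB//; last 2 first.
  - by apply: continuous_sphere_integrable; exact: dotX_continuous.
  - by apply: continuous_sphere_integrable; exact: dotX_continuous.
  apply: eq_Rintegral => x _; rewrite -mulr_sumr dot_e1.
  have := sqr_enorm (sphere_vec x); rewrite sphere_enorm expr1n (bigD1 ord0)//= => x1.
  have -> : \sum_(i < n.+2 | i != ord0) sphere_vec x i 0 ^+ 2 = 1 - sphere_vec x ord0 0 ^+ 2.
    by rewrite [X in X - _]x1; ring.
  by rewrite doubleS -[k.*2.+2]addn2 exprD; ring.
have : 'C(k.+1.*2, 2)%:R * (moment m k.*2 e1 - moment m k.+1.*2 e1) =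
    n.+1%:R * (k.+1%:R * moment m k.+1.*2 e1).
  rewrite -sumE mulr_sumr (eq_bigr (fun=> k.+1%:R * moment m k.+1.*2 e1)); last first.
    by move=> j j0; rewrite mixed_moment.
  rewrite sumr_const -[LHS]mulr_natl; congr (_%:R * _).
  by rewrite cardC1 card_ord.
have -> : 'C(k.+1.*2, 2) = (k.+1 * k.*2.+1)%N.
  by rewrite bin2 -doubleMl doubleK doubleS.
have k1 : k.+1%:R != 0 :> R by rewrite pnatr_eq0.
move=> H; apply: (mulfI k1); move: H; rewrite natrM natrD -(natr1 n.+1) -(natr1 k.*2).
lra.
Qed.

End MomentRecursion.

(** * The Laplace transform and the Bessel function *)

Section Laplace.
Variables (R : realType) (n : nat).
Local Notation S := (sphere R n.+2).
Local Notation e1 := (e1 R n.+1).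
Local Notation N := (n.+2%:R : R).
Variable m : {finite_measure set (borel S) -> \bar R}.
Hypothesis m_inv : forall (g : SO R n.+2) (A : set (borel S)), measurable A ->
  m (so_act g @^-1` A) = m A.

Definition laplace (mu : 'cV[R]_n.+2) : R := \int[m]_x expR (- dot mu x).

Lemma exp_dot_continuous mu : continuous (fun x : S => expR (- dot mu x)).
Proof.
move=> x; apply: (@continuous_comp _ _ _ (fun x : S => - dot mu x) expR);
  last exact: continuous_expR.
by apply: (@continuous_comp _ _ _ (dot mu) -%R); [exact: dot_continuous|exact: opp_continuous].
Qed.

Lemma exp_coeff_dot_continuous mu i : continuous (fun x : S => exp_coeff (- dot mu x) i).
Proof.
have -> : (fun x : S => exp_coeff (- dot mu x) i) =
    (fun x => ((-1) ^+ i / i`!%:R) * dot mu x ^+ i).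
  by apply/funext => x; rewrite /exp_coeff/= [in LHS]exprNn mulrAC.
move=> x; exact: (continuousM (@cst_continuous _ _ _ x) (@dotX_continuous _ _ i mu x)).
Qed.

Lemma series_exp_coeff_norm_le (x : R) k : `|series (exp_coeff x) k| <= expR `|x|.
Proof.
apply: (@le_trans _ _ (series (exp_coeff `|x|) k)).
  rewrite /series/=; apply: le_trans (ler_norm_sum _ _ _) _.
  by apply: ler_sum => i _; rewrite /exp_coeff/= normrM normrX normfV normr_nat.
apply: nondecreasing_cvgn_le; last exact: is_cvg_series_exp_coeff.
apply/nondecreasing_seqP => i; rewrite /series/= big_nat_recr//= lerDl.
by rewrite /exp_coeff/= divr_ge0 ?exprn_ge0.
Qed.

(** Termwise integration by dominated convergence: all partial sums are bounded by the constant
    [expR (enorm mu)], which is integrable as [m] is finite. *)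
Lemma laplace_series mu :
  series (fun i => (-1) ^+ i / i`!%:R * moment m i mu) @ \oo --> laplace mu.
Proof.
pose f k (x : borel S) := (series (exp_coeff (- dot mu x)) k)%:E.
have fc k : continuous (fun x : S => series (exp_coeff (- dot mu x)) k).
  apply: continuous_big => [|i _]; first exact: add_continuous.
  exact: exp_coeff_dot_continuous.
have intf k : (\int[m]_x f k x = (series (fun i => (-1) ^+ i / i`!%:R * moment m i mu) k)%:E)%E.
  rewrite -[LHS]fineK; last first.
    exact: integrable_fin_num (continuous_sphere_integrable m (fc k)).
  congr EFin; rewrite [LHS](_ : _ = \int[m]_x series (exp_coeff (- dot mu x)) k)//.
  rewrite /series/= (Rintegral_sum_sphere m _ _ (@exp_coeff_dot_continuous mu)).
  apply: eq_bigr => i _; rewrite /moment -RintegralZl//; last first.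
    by apply: continuous_sphere_integrable; exact: dotX_continuous.
  by apply: eq_Rintegral => x _; rewrite /exp_coeff/= [in LHS]exprNn mulrAC.
have : (\int[m]_x f k x)%E @[k --> \oo] --> (\int[m]_x (expR (- dot mu x))%:E)%E.
  apply: (@dominated_cvg _ _ _ m _ measurableT f _ (cst (expR (enorm mu))%:E)).
  - by move=> k; apply/measurable_EFinP; exact: borel_continuous_measurableR.
  - move=> x _; apply: cvg_EFin; first exact: nearW.
    exact: (is_cvg_series_exp_coeff (- dot mu x)).
  - by [].
  - exact: finite_measure_integrable_cst.
  - move=> k x _; rewrite lee_fin; apply: le_trans (series_exp_coeff_norm_le _ _) _.
    by rewrite ler_expR normrN dot_le.
have -> : (\int[m]_x (expR (- dot mu x))%:E = (laplace mu)%:E)%E.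
  rewrite /laplace /Rintegral fineK//.
  exact: integrable_fin_num (continuous_sphere_integrable m (@exp_dot_continuous mu)).
by under eq_fun do rewrite intf; move=> /fine_cvgP[_].
Qed.

Lemma moment0 : moment m 0 e1 = fine (m setT).
Proof.
rewrite /moment; transitivity (\int[m]_(x in [set: borel S]) (1 : R)).
  by apply: eq_Rintegral => x _; rewrite expr0.
by rewrite Rintegral_cst// mul1r.
Qed.

Lemma half_dim_ge1 k : 1 <= k%:R + N / 2.
Proof. by rewrite ler_wpDl// ler_pdivlMr// mul1r ler_nat. Qed.

(** Divided by the factorial, the recursion multiplies by [1 / ((2k+2)(2k+N)) = 1 / (4 (k+1)
    (k+N/2))]: one factor each for the power of 4, the factorial and the Gamma value. *)
Lemma moment_even k : moment m k.*2 e1 / (k.*2)`!%:R =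
  fine (m setT) * Gamma (N / 2) * (k`!%:R * Gamma (k%:R + N / 2))^-1 / 4 ^+ k.
Proof.
have G0 j : Gamma (j%:R + N / 2) != 0 by rewrite gt_eqF// Gamma_gt0// half_dim_ge1.
elim: k => [|k IH].
  rewrite double0 moment0 fact0 !expr0 !mul1r !divr1 add0r mulfK//.
  by have := G0 0%N; rewrite add0r.
have N0 : k.*2%:R + N != 0 :> R by rewrite -natrD pnatr_eq0 addnS.
have mE : moment m k.+1.*2 e1 = (k.*2.+1)%:R / (k.*2%:R + N) * moment m k.*2 e1.
  by rewrite mulrAC (moment_rec m_inv) natrD mulrC mulKf.
have GE : Gamma (k.+1%:R + N / 2) = (k%:R + N / 2) * Gamma (k%:R + N / 2).
  by rewrite -natr1 addrAC GammaS ?half_dim_ge1.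
have fk j : j`!%:R != 0 :> R by rewrite pnatr_eq0 -lt0n fact_gt0.
have k10 : k.+1%:R != 0 :> R by rewrite pnatr_eq0.
have k20 : k.*2.+1%:R != 0 :> R by rewrite pnatr_eq0.
have kN0 : k%:R + N / 2 != 0 by rewrite gt_eqF// (lt_le_trans _ (half_dim_ge1 k)).
have e4 : (4 : R) ^+ k != 0 by rewrite expf_neq0// pnatr_eq0.
have mk : moment m k.*2 e1 = fine (m setT) * Gamma (N / 2) *
    (k`!%:R * Gamma (k%:R + N / 2))^-1 / 4 ^+ k * (k.*2)`!%:R.
  by rewrite -IH divfK.
have k22 : k.*2.+2%:R = 2 * k.+1%:R :> R by rewrite -doubleS -muln2 natrM mulrC.
rewrite mE mk GE doubleS !factS !natrM k22 exprS -muln2 natrM.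
have kn0 : k%:R * 2 + (2 + n%:R) != 0 :> R by rewrite -natrM -!natrD pnatr_eq0 addnCA.
field; rewrite e4 G0 kn0 nat1r k10 -natrM nat1r !fk.
by rewrite muln2 k20.
Qed.

(** Since odd terms vanish, these partial sums are those of the full series at even indices, a
    subsequence. *)
Lemma laplace_even_series mu :
  series (fun k => enorm mu ^+ k.*2 * (moment m k.*2 e1 / (k.*2)`!%:R)) @ \oo -->
  laplace mu.
Proof.
have double_cvg : k.*2 @[k --> \oo] --> \oo.
  move=> A [M _ MA]; exists M => // k /= Mk; apply: MA => /=.
  by apply: leq_trans Mk _; rewrite -addnn leq_addr.
have -> : series (fun k => enorm mu ^+ k.*2 * (moment m k.*2 e1 / (k.*2)`!%:R)) =
    (fun k => series (fun i => (-1) ^+ i / i`!%:R * moment m i mu) k.*2).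
  apply/funext => k; rewrite /series/=; elim: k => [|k IH].
    by rewrite double0 !big_geq.
  rewrite doubleS !big_nat_recr//= -IH (@momentE _ _ _ m_inv k.*2.+1 mu).
  rewrite (moment_odd m_inv (k := k.*2.+1)); last by rewrite /= odd_double.
  rewrite !mulr0 addr0; congr (_ + _).
  rewrite -signr_odd odd_double expr0 (@momentE _ _ _ m_inv k.*2 mu) mul1r; ring.
apply: (@cvg_comp _ _ _ double
  (series (fun i => (-1) ^+ i / i`!%:R * moment m i mu)) _ \oo) => //.
exact: laplace_series.
Qed.

Hypothesis m_mass : m setT = (2 * pi `^ (N / 2) / Gamma (N / 2))%:E.

Lemma bessel_factor_laplace_neq0 (mu : 'cV[R]_n.+2) : mu != 0 ->
  enorm mu `^ (1 - N / 2) * besselI (N / 2 - 1) (enorm mu) =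
  laplace mu / (2 * pi) `^ (N / 2).
Proof.
move=> mu0; set r := enorm mu.
have r0 : 0 < r.
  by rewrite lt_def enorm_ge0 andbT; apply: contra_neq mu0 => /enorm_eq0.
have G0 : Gamma (N / 2) != 0.
  by have := half_dim_ge1 0; rewrite add0r => /Gamma_gt0/gt_eqF ->.
have pi0 : 0 < pi `^ (N / 2) by rewrite powR_gt0// pi_gt0.
(* The ratio of a Bessel term to the matching Laplace term: the total mass times [Gamma (N / 2)] is
   [2 * pi^(N/2)]. Multiplied by [r^(1 - N/2)] it becomes [(2 * pi)^(- N/2)]. *)
pose C := (r / 2) `^ (N / 2 - 1) / (2 * pi `^ (N / 2)).
have -> : besselI (N / 2 - 1) r = C * laplace mu.
  rewrite /besselI (_ : series _ =
    (fun k => C * series (fun k => r ^+ k.*2 * (moment m k.*2 e1 / (k.*2)`!%:R)) k)).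
    by apply/cvg_lim => //; apply: cvgMl_tmp; exact: laplace_even_series.
  apply/funext => k; rewrite /series/= mulr_sumr; apply: eq_bigr => j _.
  rewrite moment_even m_mass/= divfK// -addrA subrK.
  rewrite powRD; last by rewrite (gt_eqF (divr_gt0 r0 _))// implybT.
  rewrite -natrM powR_mulrn; last by rewrite divr_ge0// ltW.
  have e2 : (2 : R) ^+ j.*2 = 4 ^+ j by rewrite -mul2n exprM; congr (_ ^+ _); ring.
  rewrite mul2n expr_div_n e2.
  rewrite /C; set g := (_ * Gamma _)^-1; set p := (r / 2) `^ _; set q := pi `^ _ in pi0 *.
  set x := r ^+ _; set y := 4 ^+ _.
  have q0 : q != 0 by rewrite gt_eqF.
  have y0 : y != 0 by rewrite expf_neq0// pnatr_eq0.
  by field; rewrite y0 q0.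
rewrite /C powRM ?(ltW r0) ?invr_ge0// powRM ?pi_ge0//.
have -> : r `^ (1 - N / 2) = (r `^ (N / 2 - 1))^-1 by rewrite -powRN opprB.
have -> : (2^-1 : R) `^ (N / 2 - 1) = 2 / 2 `^ (N / 2).
  rewrite -powR_inv1// -powRrM mulN1r opprB powRB ?powRr1//.
  by rewrite pnatr_eq0 implybT.
have a0 : r `^ (N / 2 - 1) != 0 by rewrite gt_eqF// powR_gt0.
have b0 : (2 : R) `^ (N / 2) != 0 by rewrite gt_eqF// powR_gt0.
by field; rewrite a0 b0 gt_eqF.
Qed.

Lemma laplace0 : laplace 0 = fine (m setT).
Proof.
rewrite -moment0 /laplace /moment; apply: eq_Rintegral => x _.
by rewrite /dot trmx0 mul0mx mxE oppr0 expR0 expr0.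
Qed.

(** As [|v.x| <= |v|], the integral lies between the total mass times [expR (- |v|)] and times
    [expR |v|]. *)
Lemma laplace_cvg0 : laplace v @[v --> (0 : 'cV[R]_n.+2)] --> laplace 0.
Proof.
pose M := fine (m setT).
have bound (c : R) : \int[m]_(x in [set: borel S]) c = c * M by rewrite Rintegral_cst.
have int_cst (c : R) : m.-integrable [set: borel S] (EFin \o fun=> c).
  exact: finite_measure_integrable_cst.
have expc (s : R) : expR (s * enorm v) * M @[v --> (0 : 'cV[R]_n.+2)] --> M.
  rewrite [X in _ --> X](_ : M = expR (s * enorm (0 : 'cV[R]_n.+2)) * M); last first.
    by rewrite enorm0 mulr0 expR0 mul1r.
  have c : continuous (fun v : 'cV[R]_n.+2 => expR (s * enorm v)).
    move=> v; apply: (@continuous_comp _ _ _ (@enorm R n.+2) (fun t => expR (s * t))).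
      exact: enorm_continuous.
    apply: (@continuous_comp _ _ _ ( *%R s) expR); first exact: mulrl_continuous.
    exact: continuous_expR.
  exact: (@cvgMr_tmp _ _ _ _ _ _ M (c 0)).
apply: (@squeeze_cvgr _ (nbhs (0 : 'cV[R]_n.+2)) _ _
  (fun v => expR (-1 * enorm v) * M) (fun v => expR (1 * enorm v) * M)).
- apply: nearW => v; rewrite -!bound; apply/andP; split; apply: le_Rintegral => //.
  + exact: (continuous_sphere_integrable m (@exp_dot_continuous v)).
  + by move=> x _; rewrite ler_expR mulN1r lerN2 (le_trans (ler_norm _))// dot_le.
  + exact: (continuous_sphere_integrable m (@exp_dot_continuous v)).
  + move=> x _; rewrite ler_expR mul1r (le_trans (ler_norm _))//.
    by rewrite normrN dot_le.
- by rewrite laplace0; exact: expc.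
- by rewrite laplace0; exact: expc.
Qed.

(** Needed for the limit that defines [bessel_factor 0] to be unique. *)
Lemma dnbhs0_proper : ProperFilter ((0 : 'cV[R]_n.+2)^').
Proof.
apply: Build_ProperFilter_ex => A; rewrite /dnbhs/within/= => /nbhs_ballP[e /= e0 eA].
exists ((e / 2) *: e1); apply: eA.
  split => // i j; rewrite !mxE /ball/= sub0r normrN.
  case: (_ && _); rewrite ?mulr1 ?mulr0 ?normr0// ger0_norm; lra.
rewrite /= scaler_eq0 negb_or; apply/andP; split; first by rewrite gt_eqF// divr_gt0.
by apply/eqP => /matrixP/(_ ord0 ord0); rewrite !mxE /= => /eqP; rewrite oner_eq0.
Qed.

Theorem bessel_factorE (mu : 'cV[R]_n.+2) :
  (2 * pi) `^ (N / 2) * bessel_factor mu = laplace mu.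
Proof.
have p0 : (2 * pi) `^ (N / 2) != 0 :> R by rewrite gt_eqF// powR_gt0// mulr_gt0// pi_gt0.
suff -> : bessel_factor mu = laplace mu / (2 * pi) `^ (N / 2).
  by rewrite mulrC divfK.
rewrite /bessel_factor; case: eqP => [->|/eqP]; last exact: bessel_factor_laplace_neq0.
have ? := dnbhs0_proper; apply: cvg_lim => //.
apply: (@cvg_trans _ (laplace v / (2 * pi) `^ (N / 2) @[v --> (0 : 'cV[R]_n.+2)^'])).
  apply: near_eq_cvg; near=> v; apply/esym/bessel_factor_laplace_neq0.
  near: v; exact: nbhs_dnbhs_neq.
apply: cvgMr_tmp; apply: cvg_within_filter; exact: laplace_cvg0.
Unshelve. all: by end_near. Qed.

End Laplace.

(** * The family of von Mises-Fisher distributions *)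

Lemma pushforward_measure d d' (T1 : measurableType d) (T2 : measurableType d')
    (R : realType) (m : {measure set T1 -> \bar R}) (f : T1 -> T2) : measurable_fun [set: T1] f ->
  exists m' : {measure set T2 -> \bar R}, forall A, m' A = m (f @^-1` A).
Proof. by move=> mf; unshelve eexists (pushforward m f : {measure set T2 -> \bar R}). Qed.

(** * Transport of Radon measures along a homeomorphism *)

Section Transport.
Variables (R : realType) (T U : ptopologicalType) (f : T -> U) (g : U -> T).
Hypotheses (fK : cancel f g) (gK : cancel g f).
Hypotheses (fc : continuous f) (gc : continuous g).
Variable m : {measure set (borel T) -> \bar R}.

(** The last clause carries invariance along an equivariant map, from rotations of the sphere to the
    action on cosets. *)
Lemma homeomorphic_measure : exists m' : {measure set (borel U) -> \bar R},
  [/\ m' setT = m setT, radon m -> radon m'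
    & forall (a : T -> T) (b : U -> U) A, (forall x, f (a x) = b (f x)) ->
        m (a @^-1` (f @^-1` A)) = m (f @^-1` A) -> m' (b @^-1` A) = m' A].
Proof.
have [m' m'E] := pushforward_measure m (borel_continuous_measurable fc).
exists m'; split; first by rewrite m'E preimage_setT.
  move=> [mK mout minn].
  have comp_pre K : compact K -> compact (f @^-1` K).
    move=> cK; rewrite (_ : f @^-1` K = g @` K).
      by apply: continuous_compact => //; exact: continuous_subspaceT.
    by apply/seteqP; split => [x Kx|_ [y Ky <-]]; [exists (f x)|rewrite /= gK].
  have comp_im K : compact K -> compact (g @^-1` K).
    move=> cK; rewrite (_ : g @^-1` K = f @` K).
      by apply: continuous_compact => //; exact: continuous_subspaceT.
    by apply/seteqP; split => [x Kx|_ [y Ky <-]]; [exists (g x)|rewrite /= fK].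
  have fgK A : f @^-1` (g @^-1` A) = A by apply/seteqP; split => x; rewrite /= fK.
  have open_f A : open A -> open (f @^-1` A) by move/continuousP: fc; exact.
  have open_g A : open A -> open (g @^-1` A) by move/continuousP: gc; exact.
  split => [K cK|A mA|A oA].
  - by rewrite m'E; exact/mK/comp_pre.
  - rewrite m'E mout; last first.
      rewrite -[f @^-1` A]setTI.
      exact: (borel_continuous_measurable fc measurableT mA).
    congr ereal_inf; apply/seteqP; split => _ [V [oV AV] <-].
      exists (g @^-1` V); last by rewrite m'E fgK.
      by split; [exact: open_g|move=> y Ay; apply: AV; rewrite /= gK].
    exists (f @^-1` V); last by rewrite m'E.
    by split; [exact: open_f|move=> y Ay; apply: AV].
  - rewrite m'E minn; last exact: open_f.
    congr ereal_sup; apply/seteqP; split => _ [K [cK KA] <-].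
      exists (g @^-1` K); last by rewrite m'E fgK.
      by split; [exact: comp_im|move=> y /KA /=; rewrite gK].
    exists (f @^-1` K); last by rewrite m'E.
    by split; [exact: comp_pre|move=> y /KA].
move=> a b A fab ma; rewrite !m'E -[RHS]ma; congr (m _).
by apply/seteqP; split => x; rewrite /= fab.
Qed.

End Transport.

(** * Invariant measures on the sphere and on the quotient *)

Section InvariantMeasures.
Variables (R : realType) (n : nat).
Local Notation S := (sphere R n.+2).
Local Notation X := (homspace (so_stab R n.+1)).
Local Notation e1 := (e1 R n.+1).
Local Notation toS := (@coset_to_sphere R n.+1 : borel X -> borel S).

Lemma sdist_measurable :
  measurable_fun [set: borel S * borel S] (fun z => sdist z.1 z.2).
Proof.
have coord i : measurable_fun [set: borel S] (fun x : borel S => sphere_vec (x : S) i 0).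
  by apply: borel_continuous_measurableR; exact: sphere_coord_continuous.
apply: (@measurableT_comp _ _ _ _ _ _ (@Num.sqrt R)).
  by apply: continuous_measurable_fun; exact: sqrt_continuous.
under eq_fun do under eq_bigr do rewrite !mxE.
apply: measurable_sum => i; apply: measurable_funX; apply: measurable_funB.
  exact: (measurableT_comp (coord i) (@measurable_fst _ _ _ _)).
exact: (measurableT_comp (coord i) (@measurable_snd _ _ _ _)).
Qed.

Lemma so_actK (g : SO R n.+2) : cancel (so_act g : S -> S) (so_act (g^-1)%g).
Proof. by move=> x; apply: val_inj; rewrite /= mulmxA so_trmxK mul1mx. Qed.

Lemma so_actVK (g : SO R n.+2) : cancel (so_act (g^-1)%g : S -> S) (so_act g).
Proof. by move=> x; apply: val_inj; rewrite /= mulmxA so_mulmxV mul1mx. Qed.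

(** A rotation taking [x] to [y] takes the ball about [x] to the ball about [y]. *)
Lemma rotation_invariant_uniform (m : {measure set (borel S) -> \bar R}) :
  (forall (g : SO R n.+2) (A : set (borel S)), measurable A -> m (so_act g @^-1` A) = m A) ->
  uniformly_distributed (@sdist R n.+1) m.
Proof.
move=> m_inv x y e; have [g gx] := so_act_transitive x y.
rewrite -(m_inv g (dball (@sdist R n.+1) y e)); last first.
  by apply: open_borel; exact: (open_dball (@sdist_triangle _ _) (@sphere_openP _ _)).
congr (m _); apply/seteqP; split => z; rewrite /dball/= -gx; by rewrite sdist_act.
Qed.

Lemma rotation_invariant_measure : exists m : {measure set (borel S) -> \bar R},
  [/\ m setT = 1%E, radon m
    & forall (g : SO R n.+2) A, m (so_act g @^-1` A) = m A].
Proof.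
have [m [m1 m_radon m_iso]] := isometry_invariant_measure (@sdistxx R n.+1)
  (@sdistC R n.+1) (@sdist_triangle R n.+1) (@sphere_openP R n.+1) (@compact_sphere R n).
exists m; split => // g A; apply: (m_iso _ (so_act (g^-1)%g)).
- exact: so_actK.
- exact: so_actVK.
- by move=> x y; rewrite sdist_act.
Qed.

Lemma Gamma_half_dim_gt0 : 0 < Gamma (n.+2%:R / 2 : R).
Proof. by rewrite Gamma_gt0// ler_pdivlMr// mul1r ler_nat. Qed.

Lemma sphere_mass_gt0 : 0 < 2 * pi `^ (n.+2%:R / 2) / Gamma (n.+2%:R / 2 : R).
Proof. by rewrite divr_gt0 ?Gamma_half_dim_gt0// mulr_gt0// powR_gt0// pi_gt0. Qed.

Lemma uniform_sphere_measure_exists :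
  exists sigma : {measure set (borel S) -> \bar R}, uniform_sphere_measure sigma.
Proof.
have [m [m1 _ m_inv]] := rotation_invariant_measure.
exists (mscale (NngNum (ltW sphere_mass_gt0)) m); split => [g A _|].
  by rewrite /pushforward /mscale/=; congr (_ * _)%E; exact: m_inv.
by apply: etrans (mule1 _); rewrite -[X in (_ * X)%E]m1.
Qed.

Lemma coset_to_sphere_measurable : measurable_fun [set: borel X] toS.
Proof. by apply: borel_continuous_measurable; exact: coset_to_sphere_continuous. Qed.

Lemma invariant_homspace_measure_exists :
  exists nu : {measure set (borel X) -> \bar R},
    [/\ nu setT <> 0%E, radon nu & relatively_invariant nu].
Proof.
have [m [m1 m_radon m_inv]] := rotation_invariant_measure.
have [s [Ks sK sc]] := sphere_to_coset_exists R n.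
have s_act (g : SO R n.+2) (x : S) : s (so_act g x) = coset_act g (s x).
  by apply: (can_inj Ks); rewrite sK coset_to_sphere_act sK.
have [nu [nuT nu_radon nu_inv]] :=
  @homeomorphic_measure R S X s _ sK Ks sc (@coset_to_sphere_continuous _ _) m.
exists nu; split; [|exact: nu_radon|].
  by rewrite nuT m1; exact/eqP/onee_neq0.
exists (fun=> 1); split => [g|g A _]; first exact: ltr01.
rewrite invr1 mul1e; exact: (nu_inv (so_act g) _ _ (s_act g) (m_inv g _)).
Qed.

End InvariantMeasures.

Lemma integral_proportional_image (R : realType) (T U : ptopologicalType) (f : T -> U)
    (fc : continuous f) (nu : {measure set (borel T) -> \bar R})
    (sigma : {measure set (borel U) -> \bar R}) (h : borel U -> R) (k : R)
    (A : set (borel U)) : 0 < k ->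
  (forall B : set (borel U), measurable B -> nu (f @^-1` B) = (k%:E * sigma B)%E) ->
  measurable_fun [set: borel U] h -> (forall x, 0 <= h x) -> measurable A ->
  (\int[nu]_(x in f @^-1` A) (h (f x))%:E = k%:E * \int[sigma]_(x in A) (h x)%:E)%E.
Proof.
move=> k0 nuE hm h0 mA.
have hmA : measurable_fun A (EFin \o h).
  by apply: measurable_funTS; exact/measurable_EFinP.
rewrite -(ge0_integral_mscale sigma mA (NngNum (ltW k0)) hmA); last first.
  by move=> x _; rewrite lee_fin.
rewrite -(@ge0_integral_pushforward _ _ (borel T) (borel U) R f
  (borel_continuous_measurable fc) nu A (EFin \o h) mA hmA); last first.
  by move=> x _; rewrite lee_fin.
apply: eq_measure_integral; first exact: (borel_continuous_measurable fc).
by move=> fm B mB _; exact: nuE.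
Qed.

Section DotForm.
Variables (R : realType) (n : nat) (mu : 'cV[R]_n).

Definition dot_form (v : 'cV[R]_n) : R := (mu^T *m v) 0 0.

Lemma dot_form_is_linear : scalar dot_form.
Proof. by move=> a u v; rewrite /dot_form linearP/= !mxE. Qed.

HB.instance Definition _ := GRing.isLinear.Build R 'cV[R]_n R *%R dot_form dot_form_is_linear.

Definition dot_scalar : {scalar 'cV[R]_n} := dot_form.

End DotForm.

(** Identifies the dual space with column vectors, so that functionals [theta.1] correspond to
    parameters [mu]. *)
Lemma scalar_dot (R : realType) n (phi : {scalar 'cV[R]_n}) (v : 'cV[R]_n) :
  phi v = ((\col_i phi (delta_mx i 0))^T *m v) 0 0.
Proof.
rewrite dotE {1}[v]matrix_sum_delta linear_sum; apply: eq_bigr => i _.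
by rewrite big_ord1 linearZ/= !mxE mulrC.
Qed.

Section FiniteMeasure.
Variables (R : realType) (T : ptopologicalType) (m : {measure set (borel T) -> \bar R}).
Hypothesis m_fin : (m setT < +oo)%E.

Let k : set (borel T) -> \bar R := m.
HB.instance Definition _ := Measure.on k.
HB.instance Definition _ := Measure_isFinite.Build _ _ _ k (lty_fin_num_fun m_fin).

Lemma finite_measure_of : exists m' : {finite_measure set (borel T) -> \bar R},
  m' = m :> (set (borel T) -> \bar R).
Proof. by exists k. Qed.

End FiniteMeasure.

Section VonMisesFisher.
Variables (R : realType) (n : nat).
Local Notation S := (sphere R n.+2).
Local Notation X := (homspace (so_stab R n.+1)).
Local Notation e1 := (e1 R n.+1).
Local Notation rho := (so_natural_rep R n.+2).
Local Notation N := (n.+2%:R : R).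
Local Notation toS := (@coset_to_sphere R n.+1 : borel X -> borel S).

Variable sigma : {measure set (borel S) -> \bar R}.
Hypothesis sigma_uniform : uniform_sphere_measure sigma.

Lemma laplace_vMF (mu : 'cV[R]_n.+2) :
  (\int[sigma]_x (expR (- dot mu x))%:E = ((2 * pi) `^ (N / 2) * bessel_factor mu)%:E)%E.
Proof.
have [sigma_inv sigma_mass] := sigma_uniform.
have [m mE] : exists m : {finite_measure set (borel S) -> \bar R},
    m = sigma :> (set (borel S) -> \bar R).
  by apply: finite_measure_of; rewrite sigma_mass ltry.
have m_inv (g : SO R n.+2) (A : set (borel S)) : measurable A -> m (so_act g @^-1` A) = m A.
  by rewrite mE; exact: sigma_inv.
have m_mass : m setT = (2 * pi `^ (N / 2) / Gamma (N / 2))%:E by rewrite mE.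
rewrite (bessel_factorE m_inv m_mass) /laplace /Rintegral fineK ?mE//.
rewrite -mE; apply: integrable_fin_num => //.
exact: (continuous_sphere_integrable m (@exp_dot_continuous _ _ mu)).
Qed.

Variable nu : {measure set (borel X) -> \bar R}.
Hypothesis nu_neq0 : nu setT <> 0%E.
Hypothesis nu_radon : radon nu.
Hypothesis nu_inv : relatively_invariant nu.

Lemma radon_homspace_fin : (nu setT < +oo)%E.
Proof. by have [+ _ _] := nu_radon; apply; exact: compact_homspace. Qed.

(* The total mass is finite and positive, so the multiplier is trivial. *)
Lemma relatively_invariant_invariant (g : SO R n.+2) (A : set (borel X)) : measurable A ->
  nu (coset_act g @^-1` A) = nu A.
Proof.
have [chi [chi0 chiE]] := nu_inv; move=> mA.
suff chi1 : chi g = 1 by have := chiE g A mA; rewrite chi1 invr1 mul1e.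
have := chiE g setT measurableT; rewrite /pushforward preimage_setT.
rewrite -[nu setT]fineK ?ge0_fin_numE ?radon_homspace_fin// -EFinM => -[H].
have f0 : fine (nu setT) != 0.
  apply/eqP => H0; apply: nu_neq0.
  by rewrite -[nu setT]fineK ?H0// ge0_fin_numE ?radon_homspace_fin.
have : (chi g)^-1 = 1 by apply: (mulIf f0); rewrite mul1r -H.
by move=> /eqP; rewrite invr_eq1 => /eqP.
Qed.

Lemma image_measure_proportional : exists2 k : R, 0 < k &
  forall A : set (borel S), measurable A -> nu (toS @^-1` A) = (k%:E * sigma A)%E.
Proof.
have [sigma_inv sigma_mass] := sigma_uniform.
have [m mE] : exists m : {finite_measure set (borel S) -> \bar R},
    m = sigma :> (set (borel S) -> \bar R).
  by apply: finite_measure_of; rewrite sigma_mass ltry.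
have [p0 p0E] := pushforward_measure nu (@coset_to_sphere_measurable R n).
have [p pE] : exists p : {finite_measure set (borel S) -> \bar R},
    p = p0 :> (set (borel S) -> \bar R).
  by apply: finite_measure_of; rewrite p0E preimage_setT radon_homspace_fin.
have up : uniformly_distributed (@sdist R n.+1) p.
  rewrite pE; apply: rotation_invariant_uniform => g A mA; rewrite !p0E.
  rewrite -[RHS](relatively_invariant_invariant g); last first.
    by rewrite -[_ @^-1` _]setTI; exact: (@coset_to_sphere_measurable R n measurableT _ mA).
  by congr (nu _); apply/seteqP; split => x; rewrite /= coset_to_sphere_act.
have um : uniformly_distributed (@sdist R n.+1) m.
  by rewrite mE; apply: rotation_invariant_uniform => g A; exact: sigma_inv.
have k0 : 0 < fine (nu setT).
  by rewrite fine_gt0// radon_homspace_fin andbT lt0e measure_ge0 andbT; apply/eqP.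
exists (fine (nu setT) / (2 * pi `^ (N / 2) / Gamma (N / 2))).
  by rewrite divr_gt0// sphere_mass_gt0.
move=> A mA.
have := uniformly_distributed_proportional (@sdistxx R n.+1) (@sdistC R n.+1)
  (@sdist_triangle R n.+1) (@sphere_openP R n.+1) (@compact_sphere R n)
  (@sdist_measurable R n) up um mA.
rewrite mE pE !p0E preimage_setT sigma_mass.
set c := 2 * _ / _.
have c0 : 0 < c by exact: sphere_mass_gt0.
clearbody c; rewrite EFinM fineK; last by rewrite ge0_fin_numE ?radon_homspace_fin.
move: (nu setT) (nu _) (sigma A) => x y z H.
by rewrite muleAC -H muleAC -EFinM divff ?mul1e// gt_eqF.
Qed.

Lemma density_dot (theta : {scalar 'cV[R]_n.+2} * (SO R n.+2 -> R)) (mu : 'cV[R]_n.+2) :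
  (forall v, theta.1 v = (mu^T *m v) 0 0) -> (forall g, theta.2 g = 0) ->
  density rho e1 theta = (fun x => expR (- dot mu (toS x))).
Proof.
move=> theta1 theta2; apply/funext => x.
by rewrite /density; cbv zeta; rewrite theta1 theta2 addr0; congr (expR (- _)).
Qed.

Lemma p_tilde_image (theta : {scalar 'cV[R]_n.+2} * (SO R n.+2 -> R))
    (mu : 'cV[R]_n.+2) (k : R) (A : set (borel S)) :
  (forall v, theta.1 v = (mu^T *m v) 0 0) -> (forall g, theta.2 g = 0) -> 0 < k ->
  (forall A : set (borel S), measurable A -> nu (toS @^-1` A) = (k%:E * sigma A)%E) ->
  measurable A ->
  p_tilde rho e1 nu theta (toS @^-1` A) = (k%:E * \int[sigma]_(x in A) (expR (- dot mu x))%:E)%E.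
Proof.
move=> theta1 theta2 k0 nuE mA.
rewrite /p_tilde (density_dot theta1 theta2).
apply: (@integral_proportional_image R X S _ (@coset_to_sphere_continuous R n.+1) nu sigma
  (fun x => expR (- dot mu x)) k A k0 nuE) => //.
by apply: borel_continuous_measurableR; exact: exp_dot_continuous.
Qed.

(** The factor [k] between the image of [nu] and [sigma] cancels in the normalization. The
    finiteness half says that every functional, paired with zero, belongs to [Theta]. *)
Lemma p_theta_vMF (theta : {scalar 'cV[R]_n.+2} * (SO R n.+2 -> R))
    (mu : 'cV[R]_n.+2) :
  (forall v, theta.1 v = (mu^T *m v) 0 0) -> (forall g, theta.2 g = 0) ->
  (p_tilde rho e1 nu theta setT < +oo)%E /\
  forall A : set (borel S), measurable A ->
    pushforward (p_theta rho e1 nu theta) toS A = vMF sigma mu A.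
Proof.
move=> theta1 theta2; have [k k0 nuE] := image_measure_proportional.
have pE A (mA : measurable A) := p_tilde_image theta1 theta2 k0 nuE mA.
have pT : p_tilde rho e1 nu theta setT =
    (k * ((2 * pi) `^ (N / 2) * bessel_factor mu))%:E.
  by rewrite -(preimage_setT toS) pE// laplace_vMF.
split => [|A mA]; first by rewrite pT ltry.
rewrite /pushforward /p_theta pT pE//= /vMF muleA -EFinM invfM mulrAC mulVf ?mul1r//.
by rewrite gt_eqF.
Qed.

Lemma exponential_family_vMF :
  same_measure_family
    [set pushforward p toS | p in exponential_family rho e1 nu]
    [set vMF sigma mu | mu in [set: 'cV[R]_n.+2]].
Proof.
split => [_ [_ [theta [[tau_cont tau_hom _] _] <-] <-]|_ [mu _ <-]].
  pose mu := \col_i theta.1 (delta_mx i 0).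
  have [_ thetaE] := @p_theta_vMF theta mu (scalar_dot theta.1)
    (SO_hom_trivial tau_cont tau_hom).
  by exists (vMF sigma mu); [exists mu|].
pose theta : {scalar 'cV[R]_n.+2} * (SO R n.+2 -> R) := (dot_scalar mu, fun=> 0).
have [theta_fin thetaE] := @p_theta_vMF theta mu (fun=> erefl) (fun=> erefl).
exists (pushforward (p_theta rho e1 nu theta) toS) => //.
exists (p_theta rho e1 nu theta) => //; exists theta => //; split => //.
by split => // [|g h]; [exact: cst_continuous|rewrite addr0].
Qed.

End VonMisesFisher.

Theorem proposition4p13 (R : realType) (n' : nat) (n_ge2 : (2 <= n'.+1)%N) :
  fixed_by (so_stab R n') (so_natural_rep R n'.+1) (e1 R n') /\
  ((forall g : SO R n'.+1,
      (coset_to_sphere (gcoset (so_stab R n') g) : 'cV[R]_n'.+1)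
      = (g : 'M[R]_n'.+1) *m e1 R n') /\
   exists sphere_to_coset : sphere R n'.+1 -> homspace (so_stab R n'),
     [/\ cancel (@coset_to_sphere R n') sphere_to_coset,
         cancel sphere_to_coset (@coset_to_sphere R n'),
         continuous (@coset_to_sphere R n')
       & continuous sphere_to_coset]) /\
  (exists nu : {measure set (borel (homspace (so_stab R n'))) -> \bar R},
     [/\ nu setT <> 0%E, radon nu & relatively_invariant nu]) /\
  (exists sigma : {measure set (borel (sphere R n'.+1)) -> \bar R},
     uniform_sphere_measure sigma) /\
  forall (nu : {measure set (borel (homspace (so_stab R n'))) -> \bar R})
         (sigma : {measure set (borel (sphere R n'.+1)) -> \bar R}),
    nu setT <> 0%E -> radon nu -> relatively_invariant nu ->
    uniform_sphere_measure sigma ->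
    same_measure_family
      [set pushforward p (@coset_to_sphere R n' :
           borel (homspace (so_stab R n')) -> borel (sphere R n'.+1))
      | p in exponential_family (so_natural_rep R n'.+1) (e1 R n') nu]
      [set vMF sigma mu | mu in [set: 'cV[R]_n'.+1]].
Proof.
case: n' n_ge2 => // n _; split; first exact: natural_rep_fixed.
split.
  split; first exact: coset_to_sphereE.
  have [s [Ks sK sc]] := sphere_to_coset_exists R n.
  by exists s; split => //; exact: coset_to_sphere_continuous.
split; first exact: invariant_homspace_measure_exists.
split; first exact: uniform_sphere_measure_exists.
move=> nu sigma nu0 nu_radon nu_inv sigma_uniform.
exact: exponential_family_vMF.
Qed.
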